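(* Assume $\mathbb E[\tanh(h)]=0$, $\theta_1>\frac{1}{\mathbb E[\operatorname{sech}^2(h)]}$ and $k=o(\sqrt n)$. For every $\delta>0$ there is a constant $C>0$ such that, if the samples are drawn from $\mathbb P_S$ with hidden clique $S\subset[n]$, $|S|=k$, and $m\ge C\log\frac nk$, then any $$S_{\max}\in\operatorname*{arg\,max}_{S':|S'|=k}\phi_{S'},\qquad \phi_{S'}=\frac1m\sum_{j=1}^m\Big|\frac1k\sum_{i\in S'}\sigma_i^{(j)}\Big|,$$ satisfies $\mathbb P\left(|S\Delta S_{\max}|\ge\delta k\right)=o(1)$.
   Context: Planted random field Curie-Weiss (pRFCW) model. Let $\mu$ be a probability measure on $\mathbb R$, $h\sim\mu$, $\theta_1>0$, $[n]=\{1,\dots,n\}$, and $h_1,\dots,h_n$ i.i.d. $\sim\mu$, $\boldsymbol h=(h_1,\dots,h_n)$. For $S\subset[n]$ with $|S|=k$ define, for $\boldsymbol\sigma\in\{-1,+1\}^n$, $$\mathbb P_S(\boldsymbol\sigma\mid\boldsymbol h)\propto\exp\Big(\frac{\theta_1}{2k}\sum_{i,j\in S}\sigma_i\sigma_j+\sum_{i=1}^n h_i\sigma_i\Big)$$ (normalized) and $\mathbb P_S(\boldsymbol\sigma)=\mathbb E_{\boldsymbol h}[\mathbb P_S(\boldsymbol\sigma\mid\boldsymbol h)]$. One observes $m$ i.i.d. samples $\boldsymbol\sigma^{(1)},\dots,\boldsymbol\sigma^{(m)}$ from $\mathbb P_S$ (each with its own independent field). $\Delta$ is the symmetric difference. Asymptotics: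 $k\to\infty$ with $n=n(k)\ge k$, $m=m(k)$; $\mu,\theta_1$ fixed. *)

(* Defs.v *)
From HB Require Import structures.
From mathcomp Require Import all_boot all_order all_algebra.
From mathcomp Require Import all_classical all_reals all_analysis.
Set Implicit Arguments.
Unset Strict Implicit.
Unset Printing Implicit Defensive.
Import Order.TTheory GRing.Theory Num.Theory.
Import numFieldNormedType.Exports.
Local Open Scope classical_set_scope.
Local Open Scope ring_scope.

Section hyperbolic.
Context {R : realType}.

Definition cosh (x : R) : R := (expR x + expR (- x)) / 2.
Definition sinh (x : R) : R := (expR x - expR (- x)) / 2.
Definition tanh (x : R) : R := sinh x / cosh x.
Definition sech (x : R) : R := (cosh x)^-1.

End hyperbolic.

Section iid_law.
Context d {T : measurableType d} {R : realType}.

Definition tuple_cons n (xt : T * n.-tuple T) : n.+1.-tuple T :=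
  [tuple of xt.1 :: xt.2].

Lemma measurable_tuple_cons n : measurable_fun [set: _] (@tuple_cons n).
Proof. by apply: measurable_cons; [exact: measurable_fst|exact: measurable_snd]. Qed.

HB.instance Definition _ n :=
  isMeasurableFun.Build _ _ _ _ (@tuple_cons n) (@measurable_tuple_cons n).

(* n-fold product measure of mu, built as the image of mu \x mu^n under cons. *)
Fixpoint iid_law (mu : probability T R) n : probability (n.-tuple T) R :=
  if n is n'.+1
  then distribution (mu \x iid_law mu n')%E (@tuple_cons n')
  else dirac [tuple].

End iid_law.

Definition mutually_independent (I : finType) d d' (T : measurableType d)
    (E : measurableType d') (R : realType) (P : probability T R)
    (X : I -> {RV P >-> E}) : Prop :=
  forall (J : {set I}) (A : I -> set E),
    (forall i, measurable (A i)) ->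
    P (\bigcap_(i in [set` J]) X i @^-1` A i) =
    (\prod_(i in J) P (X i @^-1` A i))%E.

Definition symdiff (I : finType) (A B : {set I}) : {set I} :=
  (A :\: B) :|: (B :\: A).

(* Configurations are boolean n-tuples; true stands for +1 and false for -1. *)
Definition spin (R : realType) n (s : n.-tuple bool) (i : 'I_n) : R :=
  if tnth s i then 1 else -1.
Arguments spin {R n} s i.

Section model.
Context {R : realType}.

(* For empty S the coupling coefficient reads x / 0 = 0. *)
Definition pRFCW_weight (theta1 : R) n (S : {set 'I_n})
    (h : n.-tuple (measurableTypeR R)) (s : n.-tuple bool) : R :=
  expR (theta1 / (2 * #|S|%:R) *
          (\sum_(i in S) \sum_(j in S) spin s i * spin s j)
        + \sum_(i < n) tnth h i * spin s i).

Definition pRFCW_cond (theta1 : R) n (S : {set 'I_n})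
    (h : n.-tuple (measurableTypeR R)) (s : n.-tuple bool) : R :=
  pRFCW_weight theta1 S h s /
  \sum_(s' : n.-tuple bool) pRFCW_weight theta1 S h s'.

Definition pRFCW (mu : probability (measurableTypeR R) R) (theta1 : R) n
    (S : {set 'I_n}) (s : n.-tuple bool) : \bar R :=
  'E_(iid_law mu n)[fun h => pRFCW_cond theta1 S h s]%E.

Definition iid_pRFCW_samples d (T : measurableType d) (P : probability T R)
    (mu : probability (measurableTypeR R) R) (theta1 : R) n (S : {set 'I_n})
    m (X : 'I_m -> {RV P >-> n.-tuple bool}) : Prop :=
  mutually_independent X /\
  forall (j : 'I_m) (s : n.-tuple bool),
    P (X j @^-1` [set s]) = pRFCW mu theta1 S s.

Definition phi (k n m : nat) (x : 'I_m -> n.-tuple bool) (S' : {set 'I_n}) : R :=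
  m%:R^-1 * \sum_(j < m) `| k%:R^-1 * \sum_(i in S') spin (x j) i |.

Definition is_argmax_phi (k n m : nat) (x : 'I_m -> n.-tuple bool)
    (S' : {set 'I_n}) : Prop :=
  #|S'| = k /\
  forall S'' : {set 'I_n}, #|S''| = k -> phi k x S'' <= phi k x S'.

End model.
Arguments is_argmax_phi R k {n m} x S'.

(* Main.v *)
Require Import Defs.
From HB Require Import structures.
From mathcomp Require Import all_boot all_order all_algebra.
From mathcomp Require Import all_classical all_reals all_analysis.
From mathcomp Require Import perm measurable_realfun.
From mathcomp Require Import ring lra zify.
Set Implicit Arguments.
Unset Strict Implicit.
Unset Printing Implicit Defensive.
Import Order.TTheory GRing.Theory Num.Theory.
Import numFieldNormedType.Exports.
Local Open Scope classical_set_scope.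
Local Open Scope ring_scope.

(** The scores of the candidate cliques are compared with the score of [S]
    itself, sample by sample.

    The law of one sample depends only on the number of plus spins in [S]
    ([pRFCW_exchangeable]). Inside [S] this is because the fields are
    exchangeable; outside, a spin is independent of the rest given the fields and
    becomes fair on averaging, because [E[tanh h] = 0]. Consequently, if [l] is
    the ratio of the overlap of [S] and [S'] to [k], the magnetization of [S'] is
    [l] times that of [S] plus a linear form in the spins whose coefficients sum
    to zero on [S]. Such a form has fluctuations of order [1 / sqrt k] with
    subgaussian tails: an exchangeable law is dominated, up to a factor
    polynomial in [k], by product laws under which the spins of [S] have a common
    mean, and a common mean is invisible to the form ([exchangeable_mgf_le]). So,
    by Chernoff's bound on the [m] samples, the score of [S'] exceeds [l] times
    the score of [S] by a fixed [eta] with probability at most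
    [exp (- c * k * m)]. When [m >= C * log (n / k)] with [C] large, this beats
    the number of candidates, at most [n ^ k <= exp (2 * k * log (n / k))]
    because [k <= sqrt n].

    It remains to bound the score of [S] away from zero, which is where
    [theta1 > 1 / E[sech^2 h]] enters ([pRFCW_magnetization_gap]). Given the
    fields, configurations with clique magnetization below [eps] have total
    weight at most [exp (k * theta1 * eps ^+ 2 / 2)] times the partition
    function without interaction. The partition function with interaction is
    at least that of an external field [u] on the clique, times [exp (- k * u
    ^+ 2 / (2 * theta1))]. To second order in [u], the tilt adds [E[sech^2 h]
    * u ^+ 2 / 2] per site to the average of the logarithm over the fields,
    more than [u ^+ 2 / (2 * theta1)]. Averaging a small power of the ratio
    makes this quantitative without any concentration of the fields: the
    magnetization of [S] is below [eps] in absolute value with probability at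
    most [exp (- kappa * k)].

    If a set at distance at least [delta * k] maximizes the score, then either the
    magnetization of [S] is below [eps] in half of the samples, or the fluctuations
    of that set are large ([phi_le_dichotomy]); both events have vanishing
    probability. *)


(** * Product measures on tuples *)

Lemma integral_probability_cst d (T : measurableType d) (R : realType)
    (P : probability T R) (c : \bar R) : (\int[P]_x c = c)%E.
Proof. by rewrite integral_cst//= probability_setT mule1. Qed.

Section iid_law_theory.
Context d (T : measurableType d) (R : realType) (mu : probability T R).

(** Tonelli's theorem for the recursive construction of the product measure. *)
Lemma ge0_integral_iid_lawS n (F : n.+1.-tuple T -> \bar R) :
  measurable_fun [set: n.+1.-tuple T] F -> (forall t, 0 <= F t)%E ->
  (\int[iid_law mu n.+1]_t F t =
   \int[mu]_x \int[iid_law mu n]_t F (tuple_cons (x, t)))%E.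
Proof.
move=> mF F0; rewrite [LHS]ge0_integral_distribution//.
rewrite fubini_tonelli1//; last by move=> x; exact: F0.
exact: measurableT_comp.
Qed.

Lemma ge0_integral_iid_law_prod n (f : 'I_n -> T -> R) :
  (forall i, measurable_fun [set: T] (f i)) -> (forall i x, 0 <= f i x) ->
  (\int[iid_law mu n]_t (\prod_(i < n) f i (tnth t i))%:E =
   \prod_(i < n) \int[mu]_x (f i x)%:E)%E.
Proof.
have mprod p (g : 'I_p -> T -> R) : (forall i, measurable_fun [set: T] (g i)) ->
    measurable_fun [set: p.-tuple T] (fun t : p.-tuple T => (\prod_(i < p) g i (tnth t i))).
  move=> mg; apply: measurable_prod => i _.
  by apply: measurableT_comp => //; exact: measurable_tnth.
elim: n f => [|n IH] f mf f0.
  rewrite big_ord0; under eq_integral do rewrite big_ord0.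
  exact: integral_probability_cst.
rewrite ge0_integral_iid_lawS; last 2 first.
- by apply/measurable_EFinP; exact: mprod.
- by move=> t; rewrite lee_fin; apply: prodr_ge0.
rewrite big_ord_recl -IH//.
rewrite muleC -ge0_integralZl//; last 3 first.
- exact/measurable_EFinP.
- by move=> x _; rewrite lee_fin.
- by apply: integral_ge0 => t _; rewrite lee_fin; apply: prodr_ge0.
apply: eq_integral => x _; rewrite muleC -ge0_integralZl//; first last.
- by rewrite lee_fin.
- by move=> t _; rewrite lee_fin; apply: prodr_ge0.
- by apply/measurable_EFinP; apply: (mprod _ (fun i => f (lift ord0 i))) => i; exact: mf.
apply: eq_integral => t _; rewrite big_ord_recl EFinM; congr (_ * _%:E)%E.
by apply: eq_bigr => i _; rewrite /tuple_cons tnthS.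
Qed.

Definition box n (A : 'I_n -> set T) : set (n.-tuple T) :=
  [set t | forall i, A i (tnth t i)].

Lemma measurable_box n (A : 'I_n -> set T) :
  (forall i, measurable (A i)) -> measurable (box A).
Proof.
move=> mA.
rewrite (_ : box A = \bigcap_(i in [set: 'I_n]) ((fun t => tnth t i) @^-1` A i)).
  apply: fin_bigcap_measurable => // i _.
  by rewrite -[X in measurable X]setTI; exact: measurable_tnth.
by apply/seteqP; split=> [t Bt i _|t Bt i]; exact: Bt.
Qed.

Lemma iid_law_box n (A : 'I_n -> set T) : (forall i, measurable (A i)) ->
  (iid_law mu n (box A) = \prod_(i < n) mu (A i))%E.
Proof.
move=> mA.
have -> : (iid_law mu n (box A) = \int[iid_law mu n]_t (\prod_(i < n) \1_(A i) (tnth t i))%:E)%E.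
  have := integral_indic (iid_law mu n) measurableT (measurable_box mA).
  rewrite setIT => <-; apply: eq_integral => t _; congr EFin.
  rewrite indicE; case: (boolP (t \in box A)); rewrite ?inE ?notin_setE.
    move=> Bt; rewrite big1// => i _; rewrite indicE mem_set//; exact: Bt.
  move=> nBt; apply/esym/eqP/prodf_eq0.
  apply: contrapT => NE; apply: nBt => i; apply: contrapT => nA; apply: NE; exists i => //.
  by rewrite indicE memNset.
rewrite (@ge0_integral_iid_law_prod n (fun i => \1_(A i)))//.
by apply: eq_bigr => i _; rewrite integral_indic// setIT.
Qed.

Definition tuple_perm (U : Type) n (s : {perm 'I_n}) (t : n.-tuple U) : n.-tuple U :=
  [tuple tnth t (s i) | i < n].

Lemma measurable_tuple_perm n (s : {perm 'I_n}) :
  measurable_fun [set: n.-tuple T] (@tuple_perm T n s).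
Proof.
apply/measurable_fun_tnthP => i.
rewrite (_ : _ \o _ = fun t => tnth t (s i)); first exact: measurable_tnth.
by apply/funext => t /=; rewrite tnth_mktuple.
Qed.

HB.instance Definition _ n s :=
  isMeasurableFun.Build _ _ _ _ (@tuple_perm T n s) (@measurable_tuple_perm n s).

(** Both measures give a box the product of the measures of its sides, up to
    the order of the factors, and boxes form a generating pi-system. *)
Lemma iid_law_perm n (s : {perm 'I_n}) (A : set (n.-tuple T)) : measurable A ->
  distribution (iid_law mu n) (@tuple_perm T n s) A = iid_law mu n A.
Proof.
move=> mA.
pose G : set (set (n.-tuple T)) := [set B | exists2 C, (forall i, measurable (C i)) & B = box C].
apply: (@measure_unique _ _ _ G (fun _ => setT)) => //.
- apply/seteqP; split; apply: smallest_sub.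
  + exact: smallest_sigma_algebra.
  + rewrite -bigcup_seq => B [i _ [C mC <-]]; apply: sub_sigma_algebra.
    exists (fun j => if j == i then C else setT).
      by move=> j; case: ifP.
    apply/seteqP; split=> t /=.
      by move=> [_ Ct] j; case: eqP => // ->.
    by move=> /(_ i); rewrite eqxx.
  + exact: sigma_algebra_measurable.
  + by move=> _ [C mC ->]; exact: measurable_box.
- move=> _ _ [C mC ->] [D mD ->]; exists (fun i => C i `&` D i).
    by move=> i; exact: measurableI.
  apply/seteqP; split=> t /=; first by move=> [tC tD] i; split; [exact: tC|exact: tD].
  by move=> tCD; split=> i; case: (tCD i).
- by move=> _; exists (fun _ => setT) => //; apply/seteqP; split.
- by rewrite bigcup_const.
- move=> _ [C mC ->]; apply: etrans (esym (iid_law_box mC)).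
  transitivity (iid_law mu n (box (fun i => C ((s^-1)%g i)))).
    rewrite /distribution/= /pushforward.
    congr (iid_law mu n _); apply/seteqP; split=> t /= Bt i.
      by have := Bt ((s^-1)%g i); rewrite tnth_mktuple permKV.
    by rewrite tnth_mktuple; have := Bt (s i); rewrite permK.
  apply: etrans (iid_law_box _) _; first by move=> i; exact: mC.
  rewrite [LHS](reindex_inj (@perm_inj _ s))/=.
  by apply: eq_bigr => i _; rewrite permK.
- by move=> _; rewrite (le_lt_trans (probability_le1 _ _)) ?ltry.
Qed.

Lemma ge0_integral_iid_law_perm n (s : {perm 'I_n}) (F : n.-tuple T -> \bar R) :
  measurable_fun [set: n.-tuple T] F -> (forall t, 0 <= F t)%E ->
  (\int[iid_law mu n]_t F (tuple_perm s t) = \int[iid_law mu n]_t F t)%E.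
Proof.
move=> mF F0; rewrite -[LHS](ge0_integral_distribution (@tuple_perm T n s))//.
apply: eq_measure_integral => A mA _; exact: iid_law_perm.
Qed.

(** Tonelli's theorem at an arbitrary coordinate: a swap brings the coordinate
    [i] to the head, where the recursive construction separates it. *)
Lemma ge0_integral_iid_law_coord n (i : 'I_n) (a : T -> R) (g : n.-tuple T -> R) :
  measurable_fun [set: T] a -> (forall x, 0 <= a x) ->
  measurable_fun [set: n.-tuple T] g -> (forall t, 0 <= g t) ->
  (forall t t', (forall j, j != i -> tnth t j = tnth t' j) -> g t = g t') ->
  (\int[iid_law mu n]_t (a (tnth t i) * g t)%:E =
   \int[mu]_x (a x)%:E * \int[iid_law mu n]_t (g t)%:E)%E.
Proof.
case: n i g => [[//]|n] i g ma a0 mg g0 gi.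
have mag : measurable_fun [set: n.+1.-tuple T] (fun t : n.+1.-tuple T => a (tnth t i) * g t).
  apply: measurable_funM => //; apply: measurableT_comp => //; exact: measurable_tnth.
pose s := tperm ord0 i.
(* Both integrals are rewritten with the coordinates 0 and [i] exchanged. *)
rewrite -(ge0_integral_iid_law_perm s)/=; last 2 first.
- exact/measurable_EFinP.
- by move=> t; rewrite lee_fin mulr_ge0.
rewrite -(ge0_integral_iid_law_perm s (F := fun t => (g t)%:E))/=; last 2 first.
- exact/measurable_EFinP.
- by move=> t; rewrite lee_fin.
have mgs : measurable_fun [set: n.+1.-tuple T] (fun t => g (tuple_perm s t)).
  by apply: measurableT_comp => //; exact: measurable_tuple_perm.
set K := (X in _ = (_ * X)%E).
have KE x : (K = \int[iid_law mu n]_t (g (tuple_perm s (tuple_cons (x, t))))%:E)%E.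
  rewrite /K ge0_integral_iid_lawS; last 2 first.
  - exact/measurable_EFinP.
  - by move=> t; rewrite lee_fin.
  rewrite -[RHS](integral_probability_cst mu); apply: eq_integral => y _.
  apply: eq_integral => t _; congr EFin; apply: gi => j ji.
  rewrite !tnth_mktuple.
  have [k ->] : exists k, s j = lift ord0 k.
    case: (unliftP ord0 (s j)) => [k ->|s0]; first by exists k.
    by move: ji; rewrite -(inj_eq (@perm_inj _ s)) s0 tpermR eqxx.
  by rewrite !tnthS.
rewrite ge0_integral_iid_lawS; last 2 first.
- apply/measurable_EFinP; apply: (@measurableT_comp _ _ _ _ _ _ (fun t => a (tnth t i) * g t)) => //.
- by move=> t; rewrite lee_fin mulr_ge0.
rewrite muleC -ge0_integralZl//; last 3 first.
- exact/measurable_EFinP.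
- by move=> x _; rewrite lee_fin.
- by apply: integral_ge0 => t _; rewrite lee_fin.
apply: eq_integral => x _; rewrite muleC (KE x) -ge0_integralZl//; last 3 first.
- apply/measurable_EFinP; apply: (@measurableT_comp _ _ _ _ _ _ (fun t => g (tuple_perm s t))) => //.
  exact: measurableT_comp.
- by move=> t _; rewrite lee_fin.
- by rewrite lee_fin.
by apply: eq_integral => t _; rewrite tnth_mktuple tpermR EFinM.
Qed.

End iid_law_theory.

(** * The random field on one site *)

Lemma measurable_funV_gt0 d (T : measurableType d) (R : realType) (f : T -> R) :
  measurable_fun [set: T] f -> (forall x, 0 < f x) ->
  measurable_fun [set: T] (fun x => (f x)^-1).
Proof.
move=> mf f0; rewrite (_ : (fun x => _) = (fun x => expR (- ln (f x)))).
  apply: measurableT_comp => //; apply: measurable_funN.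
  by apply: measurableT_comp => //; exact: measurable_ln.
by apply/funext => x; rewrite expRN lnK ?posrE.
Qed.

Section hyperbolic_estimates.
Context {R : realType}.
Implicit Types x u y z : R.

Lemma cosh_gt0 x : 0 < cosh x.
Proof. by rewrite /cosh divr_gt0// addr_gt0 ?expR_gt0. Qed.

Lemma coshN x : cosh (- x) = cosh x.
Proof. by rewrite /cosh opprK addrC. Qed.

Lemma sech_sqr x : sech x ^+ 2 = 1 - tanh x ^+ 2.
Proof.
have := cosh_gt0 x; rewrite /tanh /sech /sinh /cosh expRN.
have := expR_gt0 x; set e := expR x => e0 h.
field; rewrite ?gt_eqF//.
by have := h; rewrite addr_gt0// ?exprn_gt0// mulr_gt0.
Qed.

Lemma sech_sqr_le1 x : sech x ^+ 2 <= 1.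
Proof. by rewrite sech_sqr gerBl sqr_ge0. Qed.

Lemma tanh_sqr_le1 x : tanh x ^+ 2 <= 1.
Proof. by rewrite -subr_ge0 -sech_sqr sqr_ge0. Qed.

Lemma norm_tanh_le1 x : `|tanh x| <= 1.
Proof. by rewrite -(@ler_sqr _ `|_|) ?nnegrE// real_normK ?num_real// expr1n tanh_sqr_le1. Qed.

Lemma measurable_cosh : measurable_fun [set: R] (@cosh R).
Proof.
apply: measurable_funM => //; apply: measurable_funD => //.
by apply: measurableT_comp => //; exact: measurable_funN.
Qed.

Lemma measurable_sinh : measurable_fun [set: R] (@sinh R).
Proof.
apply: measurable_funM => //; apply: measurable_funB => //.
by apply: measurableT_comp => //; exact: measurable_funN.
Qed.

(** From [1 - z / 2 <= expR (- (z / 2))], by squaring and inverting. Only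
    second-order accuracy is needed below; the coefficient of [z ^+ 2] is not
    sharp. *)
Lemma expR_le_quadratic z : z <= 1 / 3 -> expR z <= 1 + z + z ^+ 2.
Proof.
move=> z3.
have h : 1 - z / 2 <= expR (- (z / 2)) by exact: expR_ge1Dx.
have p : 0 < 1 - z / 2 by lra.
have -> : expR z = (expR (- (z / 2)) ^+ 2)^-1.
  by rewrite -expRM_natl -expRN; congr expR; field.
apply: (@le_trans _ _ ((1 - z / 2) ^+ 2)^-1).
  by rewrite lef_pV2 ?posrE ?exprn_gt0 ?expR_gt0// ler_sqr ?nnegrE ?expR_ge0// ltW.
rewrite -div1r ler_pdivrMr ?exprn_gt0//.
have : 0 <= z ^+ 2 * (1 - 3 * z + z ^+ 2) by rewrite mulr_ge0 ?sqr_ge0//; nra.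
nra.
Qed.

Lemma cosh_shift_le x u : 0 <= u -> cosh (x + u) <= expR u * cosh x.
Proof.
move=> u0; rewrite /cosh mulrA ler_pM2r ?invr_gt0// mulrDr -!expRD opprD.
by rewrite lerD// ler_expR; lra.
Qed.

Lemma cosh_le_shift x u : 0 <= u -> cosh x <= expR u * cosh (x + u).
Proof.
move=> u0; rewrite -coshN -[cosh (x + u)]coshN.
by have := cosh_shift_le (- (x + u)) u0; rewrite opprD subrK.
Qed.

(** The gain in the log-partition function of one spin when its field [x] is
    raised by [u]. *)
Definition lcosh_incr u x := ln (cosh (x + u) / cosh x).

Lemma lcosh_incr_bound u x : 0 <= u -> `|lcosh_incr u x| <= u.
Proof.
move=> u0; have c0 := cosh_gt0 x; have c1 := cosh_gt0 (x + u).
have c01 : cosh (x + u) / cosh x \is Num.pos by rewrite posrE divr_gt0.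
rewrite ler_norml /lcosh_incr -ler_expR -[X in _ && X]ler_expR lnK//.
rewrite ler_pdivrMr// cosh_shift_le// andbT expRN ler_pdivlMr//.
by rewrite mulrC ler_pdivrMr ?expR_gt0// mulrC cosh_le_shift.
Qed.

(** The increment equals [sinh t / (cosh x * cosh (x + t))], and
    [cosh (x + t) <= expR t * cosh x]. *)
Lemma tanh_incr_ge x t : 0 <= t ->
  sech x ^+ 2 * (t - 2 * t ^+ 2) <= tanh (x + t) - tanh x.
Proof.
move=> t0; have c0 := cosh_gt0 x; have c1 := cosh_gt0 (x + t).
have -> : tanh (x + t) - tanh x = sinh t / (cosh x * cosh (x + t)).
  have := c0; have := c1; rewrite /tanh /sinh /cosh !expRN !expRD.
  have := expR_gt0 x; have := expR_gt0 t.
  move: (expR x) (expR t) => e f f0 e0 h1 h2.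
  by field; rewrite !gt_eqF// addr_gt0// !mulr_gt0.
have h : t - 2 * t ^+ 2 <= sinh t * expR (- t).
  have e2 : expR (- (2 * t)) = expR (- t) ^+ 2 by rewrite -expRM_natl; congr expR; ring.
  have e1 : expR t * expR (- t) = 1 by rewrite -expRD subrr expR0.
  have := @expR_le_quadratic (- (2 * t)); rewrite e2 /sinh => h2.
  have {h2} := h2 ltac:(lra); nra.
have q0 : 0 <= sech x ^+ 2 := sqr_ge0 _.
apply: le_trans (ler_wpM2l q0 h) _.
rewrite /sech exprVn mulrC -mulrA; apply: ler_wpM2l.
  by rewrite /sinh divr_ge0// subr_ge0 ler_expR; lra.
have -> : (cosh x * cosh (x + t))^-1 = cosh x / cosh (x + t) / cosh x ^+ 2.
  by field; rewrite !gt_eqF.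
rewrite ler_pM2r ?invr_gt0 ?exprn_gt0// ler_pdivlMr// expRN mulrC.
by rewrite ler_pdivrMr ?expR_gt0// mulrC cosh_shift_le.
Qed.

(** Second-order Taylor bound: the derivative in [u] of the left-hand side is
    at most [tanh (x + u)] by [tanh_incr_ge]. *)
Lemma lcosh_incr_ge u x : 0 <= u ->
  u * tanh x + sech x ^+ 2 * (u ^+ 2 / 2 - 2 * u ^+ 3 / 3) <= lcosh_incr u x.
Proof.
rewrite le_eqVlt => /predU1P[<-|u0].
  by rewrite /lcosh_incr addr0 divff ?gt_eqF ?cosh_gt0// ln1 !expr0n/= !mul0r; lra.
pose T := tanh x; pose Q := sech x ^+ 2.
pose f t := lcosh_incr t x - (t * T + Q * (t ^+ 2 / 2 - 2 * t ^+ 3 / 3)).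
pose df t := tanh (x + t) - (T + Q * (t - 2 * t ^+ 2)).
have dcosh (t : R) : is_derive t (1 : R) (fun t : R => cosh (x + t)) (sinh (x + t)).
  rewrite /cosh /sinh; apply: is_derive_eq.
  rewrite /GRing.scale/=; ring.
have dl (t : R) : is_derive t (1 : R) (fun t : R => lcosh_incr t x) (tanh (x + t)).
  have c0 := cosh_gt0 x; have c1 := cosh_gt0 (x + t).
  have dl0 := @is_derive1_ln R (cosh (x + t) / cosh x) (divr_gt0 c1 c0).
  have dc0 : is_derive t (1 : R) (fun t : R => cosh (x + t) / cosh x) (sinh (x + t) / cosh x).
    by apply: is_derive_eq; rewrite /GRing.scale/=; ring.
  have := @is_derive1_comp R (@ln R) (fun t : R => cosh (x + t) / cosh x) t _ _ dl0 dc0.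
  rewrite (_ : _ * _ = tanh (x + t))//.
  by rewrite /tanh; field; rewrite ?gt_eqF.
have dff (t : R) : is_derive t (1 : R) f (df t).
  rewrite /f; apply: is_derive_eq.
  by rewrite /df /GRing.scale/=; field.
have [c cu fE] : exists2 c, c \in `]0, u[%R & f u - f 0 = df c * (u - 0).
  apply: MVT => //; apply: derivable_within_continuous => y _.
  by have [] := dff y.
have f0 : f 0 = 0.
  by rewrite /f /lcosh_incr addr0 divff ?gt_eqF ?cosh_gt0// ln1; ring.
have c0 : 0 <= c by rewrite (itvP cu).
have dc : 0 <= df c by rewrite /df; have := tanh_incr_ge x c0; rewrite -/T -/Q; lra.
have : 0 <= f u - f 0 by rewrite fE subr0 mulr_ge0 // ltW.
rewrite f0 subr0.
by rewrite /f subr_ge0.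
Qed.

Lemma measurable_sech : measurable_fun [set: R] (@sech R).
Proof. by apply: measurable_funV_gt0; [exact: measurable_cosh|exact: cosh_gt0]. Qed.

Lemma measurable_tanh : measurable_fun [set: R] (@tanh R).
Proof. by apply: measurable_funM; [exact: measurable_sinh|exact: measurable_sech]. Qed.

Lemma measurable_lcosh_incr u : measurable_fun [set: R] (lcosh_incr u).
Proof.
apply: measurableT_comp; first exact: measurable_ln.
apply: measurable_funM; last exact: measurable_sech.
by apply: measurableT_comp; [exact: measurable_cosh|exact: measurable_funD].
Qed.

Section expectations.
Context (mu : probability (measurableTypeR R) R).

Lemma integrable_of_norm_le1 (f : R -> R) :
  measurable_fun [set: R] f -> (forall x, `|f x| <= 1) ->
  mu.-integrable [set: R] (EFin \o f).
Proof.
move=> mf f1; apply: (le_integrable measurableT _ _ (finite_measure_integrable_cst mu 1 measurableT)).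
  exact/measurable_EFinP.
by move=> x _; rewrite /= lee_fin normr1.
Qed.

Lemma integral_affine (a b c : R) (f g : R -> R) :
  measurable_fun [set: R] f -> (forall x, `|f x| <= 1) ->
  measurable_fun [set: R] g -> (forall x, `|g x| <= 1) ->
  (\int[mu]_x (a + b * f x + c * g x)%:E =
   a%:E + b%:E * \int[mu]_x (f x)%:E + c%:E * \int[mu]_x (g x)%:E)%E.
Proof.
move=> mf f1 mg g1.
have If := integrable_of_norm_le1 mf f1; have Ig := integrable_of_norm_le1 mg g1.
have Ia := finite_measure_integrable_cst mu a measurableT.
have Ibf := integrableZl measurableT b If; have Icg := integrableZl measurableT c Ig.
transitivity (\int[mu]_x (((EFin \o cst a) \+ (fun x => b%:E * (f x)%:E)) \+ (fun x => c%:E * (g x)%:E)) x)%E.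
  by apply: eq_integral => x _; rewrite !EFinD !EFinM.
rewrite (integralD measurableT (integrableD measurableT Ia Ibf) Icg).
rewrite (integralD measurableT Ia Ibf) !integralZl//.
have -> // : (\int[mu]_x (EFin \o cst a) x = a%:E)%E.
exact: (integral_probability_cst mu a%:E).
Qed.

(** The first-order term of [lcosh_incr_ge] averages to zero, since the field
    satisfies [E[tanh h] = 0]; what remains is governed by [E[sech^2 h]]. The
    last term [s * u ^+ 2] is the price of exponentiating, second order in
    [s], hence negligible for small [s]. *)
Lemma laplace_lcosh_incr_le (u s : R) :
  ('E_mu[@tanh R] = 0)%E -> 0 <= u -> 0 <= s -> s * u <= 1 / 3 -> 
  (\int[mu]_x (expR (- s * lcosh_incr u x))%:E <=
   (expR (- s * (fine 'E_mu[fun x => (sech x ^+ 2)%R]%E * (u ^+ 2 / 2 - 2 * u ^+ 3 / 3) - s * u ^+ 2)))%:E)%E.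
Proof.
move=> mt u0 s0 su.
pose c := u ^+ 2 / 2 - 2 * u ^+ 3 / 3.
pose V := ('E_mu[fun x => (sech x ^+ 2)%R])%E.
have msech2 : measurable_fun [set: R] (fun x => @sech R x ^+ 2).
  by apply: measurable_funX; exact: measurable_sech.
have sech2_le1 (x : R) : `|sech x ^+ 2| <= 1.
  by rewrite ger0_norm ?sqr_ge0 ?sech_sqr_le1.
have VE : (V = \int[mu]_x (sech x ^+ 2)%:E)%E by rewrite /V unlock.
have Vfin : V \is a fin_num.
  by rewrite VE; apply: integrable_fin_num => //; exact: integrable_of_norm_le1.
have pointwise x : expR (- s * lcosh_incr u x) <=
    (1 + s ^+ 2 * u ^+ 2) + - (s * u) * tanh x + - (s * c) * sech x ^+ 2.
  have hb := lcosh_incr_bound x u0; have hl := lcosh_incr_ge x u0.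
  move: hb hl; rewrite -/c; set G := lcosh_incr u x => hb hl.
  have /ler_normlP[hb1 hb2] := hb.
  have G2 : G ^+ 2 <= u ^+ 2 by rewrite -real_normK ?num_real// ler_sqr ?nnegrE.
  have hq : expR (- s * G) <= 1 + - s * G + (- s * G) ^+ 2.
    by apply: expR_le_quadratic; apply: le_trans su; nra.
  apply: le_trans hq _.
  have : s * (u * tanh x + sech x ^+ 2 * c) <= s * G by exact: ler_wpM2l.
  have : s ^+ 2 * G ^+ 2 <= s ^+ 2 * u ^+ 2 by apply: ler_wpM2l => //; exact: sqr_ge0.
  nra.
have mG : measurable_fun [set: R] (fun x => expR (- s * lcosh_incr u x)).
  by apply: measurableT_comp => //; apply: measurable_funM => //; exact: measurable_lcosh_incr.
apply: (@le_trans _ _ (\int[mu]_x ((1 + s ^+ 2 * u ^+ 2) + - (s * u) * tanh x + - (s * c) * sech x ^+ 2)%:E)%E).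
  apply: ge0_le_integral => //.
  - exact/measurable_EFinP.
  - apply/measurable_EFinP; apply: measurable_funD; last exact: measurable_funM.
    by apply: measurable_funD => //; apply: measurable_funM => //; exact: measurable_tanh.
  - by move=> x _; rewrite lee_fin pointwise.
rewrite integral_affine//; [|exact: measurable_tanh|exact: norm_tanh_le1].
rewrite -VE -(fineK Vfin); move: mt; rewrite unlock => ->.
rewrite mule0 adde0 -EFinM -EFinD lee_fin; apply: le_trans (expR_ge1Dx _).
by rewrite -VE -/c; lra.
Qed.

Lemma expectation_sech_sqr_gt0 : 0 < fine 'E_mu[fun x => (sech x ^+ 2)%R]%E.
Proof.
have msech2 : measurable_fun [set: R] (fun x => @sech R x ^+ 2).
  by apply: measurable_funX; exact: measurable_sech.
have VE : ('E_mu[fun x => (sech x ^+ 2)%R] = \int[mu]_x (sech x ^+ 2)%:E)%E by rewrite unlock.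
have Vfin : ('E_mu[fun x => (sech x ^+ 2)%R])%E \is a fin_num.
  rewrite VE; apply: integrable_fin_num => //; apply: integrable_of_norm_le1 => // x.
  by rewrite ger0_norm ?sqr_ge0 ?sech_sqr_le1.
rewrite fine_gt0// ltey_eq Vfin andbT lt0e expectation_ge0 ?andbT; last first.
  by move=> x; rewrite sqr_ge0.
apply/eqP => V0.
have : (\int[mu]_x `|(sech x ^+ 2)%:E| = 0)%E.
  rewrite -V0 VE; apply: eq_integral => x _.
  by rewrite gee0_abs// lee_fin sqr_ge0.
have mf : measurable_fun [set: R] (fun x : R => (sech x ^+ 2)%:E) by exact/measurable_EFinP.
move/(ae_eq_integral_abs mu measurableT mf) => [N [mN N0 sub]].
have NT : N = setT.
  apply/seteqP; split=> // x _; apply: sub => /= /(_ I)/eqP.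
  by rewrite eqe sqrf_eq0 invr_eq0 gt_eqF// cosh_gt0.
by have := probability_setT mu; rewrite -NT N0 => /esym/eqP; rewrite onee_eq0.
Qed.
End expectations.
End hyperbolic_estimates.

(** * Laws that depend only on the magnetization of the clique *)

(** The terms of the expansion of [(p + (k - p)) ^ k] increase up to index
    [p] and decrease afterwards, so the largest one is at least the average.
    Equivalently, a binomial law of parameters [k] and [p / k] charges its mean
    with mass at least [1 / (k + 1)]. *)
Lemma leq_binomial_mode (k p : nat) : (p <= k)%N ->
  (k ^ k <= k.+1 * ('C(k, p) * p ^ p * (k - p) ^ (k - p)))%N.
Proof.
move=> pk; pose T j := ('C(k, j) * p ^ j * (k - p) ^ (k - j))%N.
have step j : (j < k)%N -> (T j.+1 * (j.+1 * (k - p)) = T j * ((k - j) * p))%N.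
  move=> jk; rewrite /T expnS -(subnSK jk) expnS.
  have := mul_bin_left k j; rewrite -(subnSK jk) => E.
  transitivity ((j.+1 * 'C(k, j.+1)) * (p * p ^ j * (k - p) ^ (k - j.+1) * (k - p)))%N.
    by ring.
  by rewrite E; ring.
have up j : (j <= p)%N -> (T (p - j) <= T p)%N.
  elim: j => [|j IH] jp; first by rewrite subn0.
  apply: leq_trans (IH (ltnW jp)).
  have := step (p - j.+1)%N; rewrite subnSK// => st.
  have {}st := st ltac:(lia).
  have pos : (0 < (k - (p - j.+1)) * p)%N by rewrite muln_gt0; lia.
  rewrite -(leq_pmul2r pos) -st leq_mul2l; apply/orP; right; nia.
have down j : (p + j <= k)%N -> (T (p + j) <= T p)%N.
  elim: j => [|j IH] jp; first by rewrite addn0.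
  apply: leq_trans (IH _); last lia.
  have := step (p + j)%N; rewrite -addnS => st.
  have {}st := st ltac:(lia).
  have pos : (0 < (p + j).+1 * (k - p))%N by rewrite muln_gt0; lia.
  rewrite addnS in st *; rewrite -(leq_pmul2r pos) st leq_mul2l; apply/orP; right; nia.
have max j : (j <= k)%N -> (T j <= T p)%N.
  move=> jk; case: (leqP j p) => jp; first by rewrite -(subKn jp) up// leq_subr.
  by rewrite -(subnKC (ltnW jp)) down// subnKC// ltnW.
rewrite -{1}(subnK pk) expnDn.
rewrite (_ : k.+1 * _ = \sum_(i < k.+1) T p)%N; last by rewrite sum_nat_const card_ord.
apply: leq_sum => i _.
by apply: leq_trans (max i _); [rewrite /T; lia|rewrite -ltnS].
Qed.

Section exchangeable_laws.
Context {R : realType}.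

Lemma big_tuple_bool_distr n (F : 'I_n -> bool -> R) :
  \sum_(s : n.-tuple bool) \prod_(i < n) F i (tnth s i) =
  \prod_(i < n) (F i true + F i false).
Proof.
under [RHS]eq_bigr do rewrite -big_bool.
rewrite bigA_distr_bigA.
rewrite [RHS](reindex (fun s : n.-tuple bool => [ffun i => tnth s i]))/=.
  by apply: eq_bigr => s _; apply: eq_bigr => i _; rewrite ffunE.
exists (fun f => [tuple f i | i < n]) => [s _|f _].
  by apply: eq_from_tnth => i; rewrite tnth_mktuple ffunE.
by apply/ffunP => i; rewrite ffunE tnth_mktuple.
Qed.

(** A form of Hoeffding's lemma for a spin of mean [2 * q - 1], with a
    constant that is not sharp; [expR_le_quadratic] is applied to the centered
    spin. *)
Lemma two_point_mgf_le (q y : R) : 0 <= q <= 1 -> `|y| <= 1 / 6 ->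
  q * expR y + (1 - q) * expR (- y) <= expR ((2 * q - 1) * y + 4 * y ^+ 2).
Proof.
move=> /andP[q0 q1] /ler_normlP[y1 y2].
have e1 : expR y = expR ((2 * q - 1) * y) * expR (2 * (1 - q) * y).
  by rewrite -expRD; congr expR; ring.
have e2 : expR (- y) = expR ((2 * q - 1) * y) * expR (- (2 * q * y)).
  by rewrite -expRD; congr expR; ring.
rewrite e1 e2 expRD; set E := expR ((2 * q - 1) * y).
have E0 : 0 < E by exact: expR_gt0.
have -> : forall a b, q * (E * a) + (1 - q) * (E * b) = E * (q * a + (1 - q) * b) by move=> a b; ring.
rewrite ler_pM2l//; apply: le_trans (expR_ge1Dx _).
have h1 : expR (2 * (1 - q) * y) <= 1 + 2 * (1 - q) * y + (2 * (1 - q) * y) ^+ 2.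
  by apply: expR_le_quadratic; nra.
have h2 : expR (- (2 * q * y)) <= 1 + - (2 * q * y) + (- (2 * q * y)) ^+ 2.
  by apply: expR_le_quadratic; nra.
have q1' : 0 <= 1 - q by lra.
apply: (le_trans (lerD (ler_wpM2l q0 h1) (ler_wpM2l q1' h2))).
have y0 : 0 <= y ^+ 2 := sqr_ge0 y.
have : 0 <= y ^+ 2 * (1 - q * (1 - q)) by apply: mulr_ge0 => //; nra.
nra.
Qed.

Definition nplus n (S : {set 'I_n}) (s : n.-tuple bool) : nat :=
  #|[set i in S | tnth s i]|.

(** A configuration is encoded by its plus spins inside [S], a subset of size
    [N], and its plus spins outside [S], an arbitrary subset. *)
Lemma card_nplus_ge n (S : {set 'I_n}) N :
  ('C(#|S|, N) * 2 ^ (n - #|S|) <= #|[pred s : n.-tuple bool | nplus S s == N]|)%N.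
Proof.
pose f (BD : {set 'I_n} * {set 'I_n}) : n.-tuple bool :=
  [tuple (i \in BD.1) || (i \in BD.2) | i < n].
pose A := finset.setX [set B : {set 'I_n} | (B \subset S) && (#|B| == N)] (powerset (~: S)).
have cA : #|A| = ('C(#|S|, N) * 2 ^ (n - #|S|))%N.
  by rewrite cardsX cards_draws card_powerset [#|~: S|]cardsCs finset.setCK card_ord.
have AP BD : BD \in A -> [/\ BD.1 \subset S, #|BD.1| = N & BD.2 \subset ~: S].
  by rewrite !inE => /andP[/andP[-> /eqP->] ->].
have f1 BD : BD \in A -> [set i in S | tnth (f BD) i] = BD.1.
  move=> /AP[BS _ DS]; apply/setP => i; rewrite !inE tnth_mktuple.
  case: (boolP (i \in BD.1)) => [/(fintype.subsetP BS)->//|_] /=.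
  by apply/negbTE/negP => /andP[iS /(fintype.subsetP DS)]; rewrite inE iS.
have f2 BD : BD \in A -> [set i in ~: S | tnth (f BD) i] = BD.2.
  move=> /AP[BS _ DS]; apply/setP => i; rewrite !inE tnth_mktuple.
  case: (boolP (i \in BD.2)) => [iD|_]; first by rewrite orbT andbT -finset.in_setC (fintype.subsetP DS).
  by rewrite orbF; apply/negbTE/negP => /andP[/negP iS /(fintype.subsetP BS)].
rewrite -cA -(card_in_imset (f := f)).
  apply/subset_leq_card/fintype.subsetP => _ /imsetP[BD BDA ->].
  by rewrite inE /nplus f1//; case: (AP _ BDA) => _ -> _.
by move=> [B D] [B' D'] h h' e; have := f1 _ h; have := f2 _ h; rewrite e f1// f2//= => -> ->.
Qed.

Lemma nplus_le n (S : {set 'I_n}) s : (nplus S s <= #|S|)%N.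
Proof. by apply/subset_leq_card/fintype.subsetP => i; rewrite inE => /andP[]. Qed.

(** Probabilities of a plus spin in the product law that imitates a law
    conditioned to have [N] plus spins in [S]: fair outside [S]. *)
Definition bias n (S : {set 'I_n}) (N : nat) (i : 'I_n) : R :=
  if i \in S then N%:R / #|S|%:R else 1 / 2.

Lemma prod_bernoulli_bias n (S : {set 'I_n}) (s : n.-tuple bool) (N := nplus S s) :
  (0 < #|S|)%N ->
  \prod_(i < n) bernoulli_pmf (bias S N i) (tnth s i) =
  (N%:R ^+ N * (#|S| - N)%:R ^+ (#|S| - N)) / #|S|%:R ^+ #|S| / 2 ^+ (n - #|S|).
Proof.
move=> S0; set k := #|S|.
have k0 : k%:R != 0 :> R by rewrite pnatr_eq0 -lt0n.
have Nk : (N <= k)%N := nplus_le S s.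
rewrite (bigID (mem S))/=; congr (_ * _); last first.
  rewrite (eq_bigr (fun => 2^-1)); last first.
    move=> i /negbTE iS; rewrite /bias iS /bernoulli_pmf; case: (tnth s i); lra.
  have -> : (n - k = #|~: S|)%N by rewrite [#|~: S|]cardsCs finset.setCK card_ord.
  rewrite -exprVn -prodr_const; apply: eq_bigl => i.
  by rewrite inE.
rewrite (bigID (fun i => tnth s i))/=.
rewrite (eq_bigr (fun=> N%:R / k%:R)); last first.
  by move=> i /andP[iS si]; rewrite /bernoulli_pmf si /bias iS.
rewrite [X in _ * X](eq_bigr (fun=> (k - N)%:R / k%:R)); last first.
  move=> i /andP[iS /negbTE si]; rewrite /bernoulli_pmf si /bias iS natrB//.
  by field.
rewrite (eq_bigl [in [set i in S | tnth s i]]); last by move=> i; rewrite !inE.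
rewrite prodr_const -/(nplus S s) -/N.
rewrite (eq_bigl [in S :\: [set i in S | tnth s i]]); last first.
  by move=> i; rewrite !inE; case: (i \in S) => //=; rewrite andbT.
rewrite prodr_const cardsD (finset.setIidPr _); last first.
  by apply/fintype.subsetP => i; rewrite inE => /andP[].
rewrite -/(nplus S s) -/N -/k.
rewrite !expr_div_n mulf_div -exprD subnKC//.
Qed.

(** [p] is constant on the set of configurations with as many plus spins in
    [S] as [s], which bounds [p s] by the inverse of the size of that set; the
    product law charges the same set with mass at least [1 / (k + 1)] by
    [leq_binomial_mode]. Replacing exchangeability by independence in this way
    costs only a polynomial factor, which is harmless against bounds
    exponential in [k]. *)
Lemma exchangeable_le_bernoulli n (S : {set 'I_n}) (p : n.-tuple bool -> R) s :
  (forall s, 0 <= p s) -> \sum_s p s = 1 ->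
  (forall s s', nplus S s = nplus S s' -> p s = p s') -> (0 < #|S|)%N ->
  p s <= #|S|.+1%:R * \prod_(i < n) bernoulli_pmf (bias S (nplus S s) i) (tnth s i).
Proof.
move=> p0 p1 pE S0; rewrite prod_bernoulli_bias//.
set N := nplus S s; set k := #|S|.
have Nk : (N <= k)%N := nplus_le S s.
pose K : R := ('C(k, N) * 2 ^ (n - k))%:R.
have K0 : 0 < K by rewrite ltr0n muln_gt0 bin_gt0 Nk expn_gt0.
have k0 : 0 < k%:R ^+ k :> R by rewrite exprn_gt0// ltr0n.
rewrite -(ler_pM2r K0); apply: (@le_trans _ _ 1).
  rewrite -p1 (bigID (fun s' => nplus S s' == N))/= -[X in X <= _]addr0.
  apply: lerD; last by apply: sumr_ge0.
  rewrite (eq_bigr (fun=> p s)); last by move=> s' /eqP/pE.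
  rewrite sumr_const -mulr_natr ler_wpM2l// ler_nat.
  by apply: leq_trans (card_nplus_ge S N) _; apply: subset_leq_card; apply/fintype.subsetP.
have mode : k%:R ^+ k <= k.+1%:R * ('C(k, N)%:R * N%:R ^+ N * (k - N)%:R ^+ (k - N)) :> R.
  by rewrite -!natrX -!natrM ler_nat leq_binomial_mode.
rewrite /K natrM natrX.
have -> : forall a b c d e f : R, e != 0 -> b != 0 -> f * (a * c / b / e) * (d * e) = f * (d * a * c) / b.
  by move=> a b c d e f e0 b0; field; rewrite e0 b0.
  by rewrite ler_pdivlMr// mul1r.
  by rewrite expf_neq0.
by rewrite gt_eqF.
Qed.

Definition spin_form n (c : 'I_n -> R) (s : n.-tuple bool) : R :=
  \sum_(i < n) c i * spin s i.

(** Under each of the dominating product laws, all spins of [S] have the same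
    mean, so that this unknown mean drops out of a linear form whose
    coefficients sum to zero on [S]. One factor [k + 1] comes from
    [exchangeable_le_bernoulli], the other from summing over the possible numbers
    of plus spins. *)
Lemma exchangeable_mgf_le n (S : {set 'I_n}) (p : n.-tuple bool -> R) (c : 'I_n -> R) :
  (forall s, 0 <= p s) -> \sum_s p s = 1 ->
  (forall s s', nplus S s = nplus S s' -> p s = p s') -> (0 < #|S|)%N ->
  \sum_(i in S) c i = 0 -> (forall i, `|c i| <= 1 / 6) ->
  \sum_s p s * expR (spin_form c s) <=
  #|S|.+1%:R ^+ 2 * expR (4 * \sum_(i < n) c i ^+ 2).
Proof.
move=> p0 p1 pE S0 cS c6; set k := #|S|.
have k0 : (0 : R) < k%:R by rewrite ltr0n.
have bias01 N i : (N <= k)%N -> 0 <= bias S N i <= 1.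
  move=> Nk; rewrite /bias; case: ifP => _; last by lra.
  by rewrite divr_ge0//= ler_pdivrMr// mul1r ler_nat.
have bern0 N i b : (N <= k)%N -> 0 <= bernoulli_pmf (bias S N i) b.
  by move=> /(bias01 _ i)/andP[h0 h1]; rewrite /bernoulli_pmf; case: b => //; rewrite subr_ge0.
have expE s : expR (spin_form c s) = \prod_(i < n) expR (c i * spin s i).
  by rewrite /spin_form expR_sum.
have mgfN N : (N <= k)%N ->
    \sum_(s : n.-tuple bool) \prod_(i < n) (bernoulli_pmf (bias S N i) (tnth s i) * expR (c i * spin s i)) <=
    expR (4 * \sum_(i < n) c i ^+ 2).
  move=> Nk; rewrite (big_tuple_bool_distr (fun i b => bernoulli_pmf (bias S N i) b * expR (c i * (if b then 1 else -1)))).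
  have -> : expR (4 * \sum_(i < n) c i ^+ 2) =
      \prod_(i < n) expR ((2 * bias S N i - 1) * c i + 4 * c i ^+ 2).
    rewrite -expR_sum big_split/= -mulr_sumr [X in X + _](_ : _ = 0) ?add0r//.
    rewrite (bigID (mem S))/= [X in X + _](eq_bigr (fun i => (2 * (N%:R / k%:R) - 1) * c i)).
      rewrite -mulr_sumr cS mulr0 add0r big1// => i /negbTE iS.
      by rewrite /bias iS; lra.
    by move=> i iS; rewrite /bias iS.
  apply: ler_prod => i _; apply/andP; split.
    by apply: addr_ge0; apply: mulr_ge0; rewrite ?expR_ge0// bern0.
  by rewrite /bernoulli_pmf mulr1 mulrN1; apply: two_point_mgf_le; [exact: bias01|exact: c6].
pose W N s := \prod_(i < n) (bernoulli_pmf (bias S N i) (tnth s i) * expR (c i * spin s i)).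
have W0 N s : (N <= k)%N -> 0 <= W N s.
  by move=> Nk; apply: prodr_ge0 => i _; rewrite mulr_ge0 ?expR_ge0// bern0.
apply: (@le_trans _ _ (\sum_(s : n.-tuple bool) k.+1%:R * \sum_(N < k.+1) W N s)).
  apply: ler_sum => s _.
  have Nk : (nplus S s < k.+1)%N by rewrite ltnS nplus_le.
  apply: (@le_trans _ _ (k.+1%:R * W (nplus S s) s)).
    rewrite /W big_split/= -expE mulrA; apply: ler_wpM2r; first exact: expR_ge0.
    exact: exchangeable_le_bernoulli.
  apply: ler_wpM2l => //; rewrite (bigD1 (Ordinal Nk))//= lerDl.
  by apply: sumr_ge0 => i _; apply: W0; rewrite -ltnS.
rewrite -mulr_sumr exchange_big/= expr2 -mulrA; apply: ler_wpM2l => //.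
rewrite [X in _ <= X](_ : _ = \sum_(N < k.+1) expR (4 * \sum_(i < n) c i ^+ 2)); last first.
  by rewrite sumr_const card_ord mulr_natl.
by apply: ler_sum => N _; apply: mgfN; rewrite -ltnS.
Qed.

End exchangeable_laws.

(** * Comparing the scores of two candidate cliques *)

Section union_bound.
Context {R : realType}.

(** The indicator of [0 <= sum] is at most the exponential of the sum, whose
    expectation factorizes over the samples. *)
Lemma iid_chernoff (T : finType) m (p f : T -> R) : (forall s, 0 <= p s) ->
  \sum_(x : {ffun 'I_m -> T} | 0 <= \sum_(j < m) f (x j)) \prod_(j < m) p (x j)
  <= (\sum_s p s * expR (f s)) ^+ m.
Proof.
move=> p0; rewrite -[X in _ ^+ X]card_ord -prodr_const bigA_distr_bigA/=.
rewrite [X in _ <= X](bigID (fun x : {ffun 'I_m -> T} => 0 <= \sum_(j < m) f (x j)))/=.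
rewrite -[X in X <= _]addr0; apply: lerD.
  apply: ler_sum => x f0; rewrite big_split/= -expR_sum -[X in X <= _]mulr1.
  by apply: ler_wpM2l; [exact: prodr_ge0|rewrite -expR0 ler_expR].
by apply: sumr_ge0 => x _; apply: prodr_ge0 => j _; rewrite mulr_ge0// expR_ge0.
Qed.

Definition magnetization n (S : {set 'I_n}) (s : n.-tuple bool) : R := \sum_(i in S) spin s i.

(** Coefficients of the fluctuation of the spins of [S'] around the part
    explained by the spins of [S]; they sum to zero on [S]. *)
Definition overlap_coef n (S S' : {set 'I_n}) (i : 'I_n) : R :=
  (i \in S')%:R - #|S :&: S'|%:R / #|S|%:R * (i \in S)%:R.

Lemma magnetization_overlap n (S S' : {set 'I_n}) s :
  magnetization S' s = #|S :&: S'|%:R / #|S|%:R * magnetization S s +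
    spin_form (overlap_coef S S') s.
Proof.
rewrite /spin_form /overlap_coef; under eq_bigr do rewrite mulrBl -[X in _ - X]mulrA.
have mE A : magnetization A s = \sum_(i < n) (i \in A)%:R * spin s i.
  by rewrite /magnetization big_mkcond; apply: eq_bigr => i _; case: (i \in A); rewrite ?mul1r ?mul0r.
by rewrite sumrB -mulr_sumr -!mE addrC subrK.
Qed.

Lemma overlap_ratio01 n (S S' : {set 'I_n}) : 0 <= (#|S :&: S'|%:R / #|S|%:R : R) <= 1.
Proof.
rewrite divr_ge0//=; have [S0|S0] := posnP #|S|; first by rewrite S0 invr0 mulr0.
by rewrite ler_pdivrMr ?ltr0n// mul1r ler_nat subset_leq_card// finset.subsetIl.
Qed.

Lemma sum_overlap_coef n (S S' : {set 'I_n}) : (0 < #|S|)%N ->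
  \sum_(i in S) overlap_coef S S' i = 0.
Proof.
move=> S0; rewrite /overlap_coef sumrB.
have -> : \sum_(i in S) (i \in S')%:R = #|S :&: S'|%:R :> R.
  rewrite -sumr_const big_mkcond [RHS]big_mkcond/=.
  by apply: eq_bigr => i _; rewrite !inE; case: (i \in S); case: (i \in S').
rewrite (eq_bigr (fun=> #|S :&: S'|%:R / #|S|%:R)); last by move=> i ->; rewrite mulr1.
by rewrite [X in _ - X]sumr_const -[X in _ - X]mulr_natr divfK ?subrr// pnatr_eq0 -lt0n.
Qed.

Lemma overlap_coef_norm_le1 n (S S' : {set 'I_n}) i : `|overlap_coef S S' i| <= 1.
Proof.
rewrite /overlap_coef; have /andP[] := overlap_ratio01 S S'.
set l := _ / _ => l0 l1; rewrite ler_norml.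
by case: (i \in S'); case: (i \in S) => /=; apply/andP; split; lra.
Qed.

Lemma sum_overlap_coef_sqr n (S S' : {set 'I_n}) :
  \sum_(i < n) overlap_coef S S' i ^+ 2 <= #|S|%:R + #|S'|%:R.
Proof.
have cE (A : {set 'I_n}) : #|A|%:R = \sum_(i < n) (i \in A)%:R :> R.
  by rewrite -sumr_const big_mkcond/=; apply: eq_bigr => i _; case: (i \in A).
rewrite (cE S) (cE S') -big_split/=; apply: ler_sum => i _.
rewrite /overlap_coef; have /andP[] := overlap_ratio01 S S'.
set l := _ / _ => l0 l1.
by case: (i \in S'); case: (i \in S) => /=; nra.
Qed.

Lemma card_symdiff (T : finType) (S S' : {set T}) : #|S| = #|S'| ->
  (#|symdiff S S'| <= 2 * (#|S| - #|S :&: S'|))%N.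
Proof.
move=> SS'; apply: leq_trans (leq_card_setU _ _) _.
by rewrite !cardsD [S' :&: S]finset.setIC -SS'; lia.
Qed.

(** Write [l] for the ratio of the overlap of [S] and [S'] to [k], at most
    [1 - delta / 2]. The score of [S'] is at most [l] times that of [S] plus
    the average of the fluctuations, so if it reaches the score of [S], the
    fluctuations are at least [delta / 2] times the score of [S]; and that
    score is at least [eps / 2] unless the magnetization of [S] per site is at
    most [eps] in absolute value in half of the samples. *)
Lemma phi_le_dichotomy n m (k : nat) (S S' : {set 'I_n}) (x : 'I_m -> n.-tuple bool)
    (delta eps : R) : (0 < m)%N -> (0 < k)%N -> #|S| = k -> #|S'| = k ->
  0 < delta -> 0 < eps ->
  delta * k%:R <= #|symdiff S S'|%:R -> phi k x S <= phi k x S' :> R ->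
  0 <= \sum_(j < m) ((`|magnetization S (x j)| <= eps * k%:R)%R%:R - 1 / 2 : R) \/
  0 <= \sum_(j < m) (`|spin_form (overlap_coef S S') (x j)| - delta * eps / 4 * k%:R).
Proof.
move=> m0 k0 Sk S'k d0 e0 dS phS.
have kR : (0 : R) < k%:R by rewrite ltr0n.
have mR : (0 : R) < m%:R by rewrite ltr0n.
pose A : R := \sum_(j < m) `|magnetization S (x j)|.
pose B : R := \sum_(j < m) `|magnetization S' (x j)|.
pose X : R := \sum_(j < m) `|spin_form (overlap_coef S S') (x j)|.
pose N : R := \sum_(j < m) (`|magnetization S (x j)| <= eps * k%:R)%R%:R.
pose l : R := #|S :&: S'|%:R / #|S|%:R.
have phiE T : phi k x T = m%:R^-1 * (k%:R^-1 * \sum_(j < m) `|magnetization T (x j)|) :> R.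
  rewrite /phi; congr (_ * _); rewrite mulr_sumr; apply: eq_bigr => j _.
  by rewrite normrM ger0_norm// invr_ge0.
have AB : A <= B.
  by move: phS; rewrite !phiE !ler_pM2l ?invr_gt0.
have /andP[l0 l1] : 0 <= l <= 1 := overlap_ratio01 S S'.
have BX : B <= l * A + X.
  rewrite /B /A /X mulr_sumr -big_split/=; apply: ler_sum => j _.
  rewrite (magnetization_overlap S S') -/l; apply: le_trans (ler_normD _ _) _.
  by rewrite normrM (ger0_norm l0).
have ld : l <= 1 - delta / 2.
  have : delta * k%:R <= 2 * (k%:R - #|S :&: S'|%:R).
    apply: le_trans dS _; rewrite -natrB; last by rewrite -Sk subset_leq_card// finset.subsetIl.
    by rewrite -natrM ler_nat -Sk card_symdiff// Sk S'k.
  rewrite /l Sk ler_pdivrMr// => h; nra.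
have AN : eps * k%:R * (m%:R - N) <= A.
  have -> : m%:R = \sum_(j < m) 1 :> R by rewrite sumr_const card_ord.
  rewrite /N -sumrB mulr_sumr; apply: ler_sum => j _.
  case: (leP `|_| _) => [_|/ltW h]; first by rewrite subrr mulr0.
  by rewrite subr0 mulr1.
have ek : 0 < eps * k%:R by exact: mulr_gt0.
rewrite !sumrB !sumr_const !card_ord -/N -/X.
rewrite -[1 / 2 *+ m]mulr_natr -[_ * k%:R *+ m]mulr_natr.
case: (leP (1 / 2 * m%:R) N) => Nm; [left|right]; first by rewrite subr_ge0.
have h1 : eps * k%:R * (m%:R / 2) <= A.
  by apply: le_trans AN; rewrite ler_pM2l//; lra.
have A0 : 0 <= A by apply: sumr_ge0.
have : (delta / 2) * A <= X by nra.
have : (delta / 2) * (eps * k%:R * (m%:R / 2)) <= (delta / 2) * A by rewrite ler_wpM2l//; lra.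
lra.
Qed.

(** The exponent combines [- eta ^+ 2 / 16] from the threshold and
    [8 * (eta / 16) ^+ 2 = eta ^+ 2 / 32] from [exchangeable_mgf_le], as the
    squares of the coefficients sum to at most [2 * k]. *)
Lemma exchangeable_norm_mgf_le n (S S' : {set 'I_n}) (p : n.-tuple bool -> R) (eta : R) :
  (forall s, 0 <= p s) -> \sum_s p s = 1 ->
  (forall s s', nplus S s = nplus S s' -> p s = p s') -> (0 < #|S|)%N ->
  #|S'| = #|S| -> 0 <= eta <= 1 ->
  \sum_s p s * expR (eta / 16 * (`|spin_form (overlap_coef S S') s| - eta * #|S|%:R)) <=
  2 * #|S|.+1%:R ^+ 2 * expR (- (eta ^+ 2 / 32 * #|S|%:R)).
Proof.
move=> p0 p1 pE S0 S'S /andP[eta0 eta1]; set k := #|S|; set t := eta / 16.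
have t0 : 0 <= t by rewrite /t; lra.
pose c := overlap_coef S S'.
have bnd (b : R) : `|b| = t ->
    \sum_s p s * expR (b * spin_form c s) <= k.+1%:R ^+ 2 * expR (8 * t ^+ 2 * k%:R).
  move=> bt; under eq_bigr => s _.
    rewrite (_ : b * spin_form c s = spin_form (fun i => b * c i) s); last first.
      by rewrite /spin_form mulr_sumr; apply: eq_bigr => i _; rewrite mulrA.
    over.
  apply: le_trans (exchangeable_mgf_le p0 p1 pE S0 _ _) _.
  - by rewrite -mulr_sumr sum_overlap_coef// mulr0.
  - move=> i; rewrite normrM bt; have := overlap_coef_norm_le1 S S' i; rewrite -/c => ci.
    apply: le_trans (ler_piMr t0 ci) _; rewrite /t; lra.
  - apply: ler_wpM2l; first by rewrite exprn_ge0.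
    rewrite ler_expR; under eq_bigr do rewrite exprMn.
    rewrite -mulr_sumr; have := sum_overlap_coef_sqr S S'; rewrite S'S -/k -/c => h.
    have -> : b ^+ 2 = t ^+ 2 by rewrite -bt real_normK ?num_real.
    have := ler_wpM2l (sqr_ge0 t) h; lra.
apply: (@le_trans _ _ (expR (- (t * eta * k%:R)) *
    (\sum_s p s * expR (t * spin_form c s) + \sum_s p s * expR (- t * spin_form c s)))).
  rewrite -big_split/= mulr_sumr; apply: ler_sum => s _.
  rewrite -mulrDr mulrCA ler_wpM2l//.
  rewrite mulrBr expRD mulrC mulrA; apply: ler_pM; rewrite ?expR_ge0//.
  case: (leP 0 (spin_form c s)) => h.
    by rewrite ger0_norm// lerDl expR_ge0.
  by rewrite ltr0_norm// mulrN mulNr lerDr expR_ge0.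
apply: (@le_trans _ _ (expR (- (t * eta * k%:R)) * (2 * (k.+1%:R ^+ 2 * expR (8 * t ^+ 2 * k%:R))))).
  apply: ler_wpM2l; first exact: expR_ge0.
  by rewrite mulr2n mulrDl mul1r lerD// bnd ?normrN// ger0_norm.
have -> : expR (- (eta ^+ 2 / 32 * k%:R)) =
    expR (- (t * eta * k%:R)) * expR (8 * t ^+ 2 * k%:R).
  by rewrite -expRD; congr expR; rewrite /t; field.
by rewrite le_eqVlt; apply/orP; left; apply/eqP; ring.
Qed.

Definition has_far_rival n m (k : nat) (delta : R) (S : {set 'I_n})
    (x : 'I_m -> n.-tuple bool) : bool :=
  [exists S' : {set 'I_n}, [&& #|S'| == k, delta * k%:R <= #|symdiff S S'|%:R &
    phi k x S <= phi k x S' :> R]].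

(** Union bound over the candidate cliques. The rate per candidate is of order
    [k * m], because the fluctuation of one sample is already subgaussian with
    variance of order [1 / k]; this is what [log (n / k)] samples need to beat
    the number of candidates. The event that the magnetization of [S] is small
    in half of the samples does not involve the candidate and is counted
    once. *)
Lemma sum_far_rival_le n m (k : nat) (S : {set 'I_n}) (p : n.-tuple bool -> R)
    (delta eps kappa : R) (eta := delta * eps / 4) :
  (0 < m)%N -> (0 < k)%N -> #|S| = k -> 0 < kappa -> 0 < delta <= 1 -> 0 < eps <= 1 ->
  (forall s, 0 <= p s) -> \sum_s p s = 1 ->
  (forall s s', nplus S s = nplus S s' -> p s = p s') ->
  \sum_(s | `|magnetization S s| <= eps * k%:R) p s <= expR (- (kappa * k%:R)) ->
  \sum_(x : {ffun 'I_m -> n.-tuple bool} | has_far_rival k delta S x) \prod_(j < m) p (x j) <=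
  (2 * expR (- (kappa * k%:R / 2))) ^+ m +
  'C(n, k)%:R * (2 * k.+1%:R ^+ 2 * expR (- (eta ^+ 2 / 32 * k%:R))) ^+ m.
Proof.
move=> m0 k0 Sk kappa0 /andP[d0 d1] /andP[e0 e1] p0 p1 pE psmall.
have eta01 : 0 < eta <= 1.
  by apply/andP; split; rewrite /eta; [rewrite divr_gt0// mulr_gt0|nra].
have eta0 : 0 < eta by case/andP: eta01.
pose f s : R := (`|magnetization S s| <= eps * k%:R)%R%:R - 1 / 2.
pose g S' s : R := `|spin_form (overlap_coef S S') s| - eta * k%:R.
pose Q (x : {ffun 'I_m -> n.-tuple bool}) := \prod_(j < m) p (x j).
have Q0 x : 0 <= Q x by apply: prodr_ge0.
have union_bound : \sum_(x : {ffun 'I_m -> n.-tuple bool} | has_far_rival k delta S x) Q x <=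
    \sum_(x : {ffun 'I_m -> n.-tuple bool} | 0 <= \sum_(j < m) f (x j)) Q x +
    \sum_(S' : {set 'I_n} | #|S'| == k) \sum_(x : {ffun 'I_m -> n.-tuple bool} | 0 <= \sum_(j < m) g S' (x j)) Q x.
  under [X in _ + X]eq_bigr do rewrite big_mkcond/=.
  rewrite exchange_big/= big_mkcond [X in X + _]big_mkcond -big_split/=.
  apply: ler_sum => x _.
  have s0 : 0 <= \sum_(S' : {set 'I_n} | #|S'| == k) (if 0 <= \sum_(j < m) g S' (x j) then Q x else 0).
    by apply: sumr_ge0 => S' _; case: ifP.
  case: ifPn => [/existsP[S' /and3P[/eqP S'k dS phS]]|_]; last first.
    by apply: addr_ge0 => //; case: ifP.
  have [hf|hg] := phi_le_dichotomy m0 k0 Sk S'k d0 e0 dS phS.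
    by rewrite /f hf lerDl.
  apply: (@le_trans _ _ (0 + Q x)); first by rewrite add0r.
  apply: lerD; first by case: ifP.
  rewrite (bigD1 S') ?S'k//= /g hg lerDl; apply: sumr_ge0 => T _; by case: ifP.
apply: le_trans union_bound _; apply: lerD.
  have e x : (0 <= \sum_(j < m) f (x j)) = (0 <= \sum_(j < m) kappa * k%:R * f (x j)).
    by rewrite -mulr_sumr pmulr_rge0// mulr_gt0// ltr0n.
  under eq_bigl do rewrite e.
  apply: le_trans (iid_chernoff m (fun s => kappa * k%:R * f s) p0) _.
  apply: lerXn2r; rewrite ?nnegrE ?mulr_ge0 ?expR_ge0//.
    by apply: sumr_ge0 => s _; rewrite mulr_ge0// expR_ge0.
  rewrite (bigID (fun s => `|magnetization S s| <= eps * k%:R))/=.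
  rewrite [2 * _]mulr_natl mulr2n; apply: lerD.
    rewrite (eq_bigr (fun s => p s * expR (kappa * k%:R / 2))); last first.
      by move=> s h; rewrite /f h /=; congr (_ * expR _); field.
    rewrite -mulr_suml; apply: le_trans (ler_wpM2r (expR_ge0 _) psmall) _.
    by rewrite -expRD ler_expR; lra.
  rewrite (eq_bigr (fun s => p s * expR (- (kappa * k%:R / 2)))); last first.
    by move=> s /negbTE h; rewrite /f h /=; congr (_ * expR _); field.
  rewrite -mulr_suml ler_piMl ?expR_ge0// -[X in _ <= X]p1.
  rewrite [X in _ <= X](bigID (fun s => `|magnetization S s| <= eps * k%:R))/= lerDr.
  exact: sumr_ge0.
have -> : 'C(n, k)%:R = \sum_(S' : {set 'I_n} | #|S'| == k) 1 :> R.
  rewrite sumr_const; congr (_%:R).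
  by rewrite -[n in 'C(n, k)]card_ord -card_draws; apply: eq_card => A; rewrite !inE.
rewrite mulr_suml; apply: ler_sum => S' /eqP S'k; rewrite mul1r.
have e x : (0 <= \sum_(j < m) g S' (x j)) = (0 <= \sum_(j < m) eta / 16 * g S' (x j)).
  by rewrite -mulr_sumr pmulr_rge0// divr_gt0.
under eq_bigl do rewrite e.
apply: le_trans (iid_chernoff m (fun s => eta / 16 * g S' s) p0) _.
apply: lerXn2r; rewrite ?nnegrE.
- by apply: sumr_ge0 => s _; rewrite mulr_ge0// expR_ge0.
- by rewrite !mulr_ge0 ?expR_ge0// exprn_ge0.
have := @exchangeable_norm_mgf_le n S S' p eta p0 p1 pE.
by rewrite /g Sk => -> //; rewrite ltW//; case/andP: eta01.
Qed.

End union_bound.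

(** * Symmetries of the planted model *)

Section symmetry.
Context {R : realType} (mu : probability (measurableTypeR R) R) (theta : R).
Context (mean_tanh : ('E_mu[fun x : R => tanh x] = 0)%E).
Context (n : nat) (S : {set 'I_n}).
Implicit Types (h : n.-tuple (measurableTypeR R)) (s : n.-tuple bool).

Definition gibbs_coupling s : R := expR (theta / (2 * #|S|%:R) * magnetization S s ^+ 2).

Lemma pRFCW_weightE h s : pRFCW_weight theta S h s =
  gibbs_coupling s * \prod_(i < n) expR (tnth h i * spin s i).
Proof.
rewrite /pRFCW_weight expRD expR_sum; congr (expR (_ * _) * _).
by rewrite expr2 /magnetization mulr_suml; apply: eq_bigr => i _; rewrite mulr_sumr.
Qed.

Lemma pRFCW_weight_gt0 h s : 0 < pRFCW_weight theta S h s.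
Proof. exact: expR_gt0. Qed.

Lemma partition_gt0 h : 0 < \sum_s pRFCW_weight theta S h s.
Proof.
rewrite (bigD1 [tuple true | i < n])//= ltr_pwDl ?pRFCW_weight_gt0//.
by apply: sumr_ge0 => s _; rewrite ltW ?pRFCW_weight_gt0.
Qed.

Lemma pRFCW_cond_ge0 h s : 0 <= pRFCW_cond theta S h s.
Proof. by rewrite divr_ge0// ltW// ?pRFCW_weight_gt0// partition_gt0. Qed.

Lemma sum_pRFCW_cond h : \sum_s pRFCW_cond theta S h s = 1.
Proof. by rewrite -mulr_suml divff// gt_eqF// partition_gt0. Qed.

Lemma measurable_pRFCW_weight s :
  measurable_fun [set: n.-tuple (measurableTypeR R)] (fun h => pRFCW_weight theta S h s).
Proof.
apply: measurableT_comp => //; apply: measurable_funD => //.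
apply: measurable_sum => i; apply: measurable_funM => //; exact: measurable_tnth.
Qed.

Lemma measurable_pRFCW_cond s :
  measurable_fun [set: n.-tuple (measurableTypeR R)] (fun h => pRFCW_cond theta S h s).
Proof.
apply: measurable_funM; first exact: measurable_pRFCW_weight.
apply: measurable_funV_gt0; last exact: partition_gt0.
by apply: measurable_sum => s'; exact: measurable_pRFCW_weight.
Qed.

Lemma pRFCW_integral s :
  (pRFCW mu theta S s = \int[iid_law mu n]_h (pRFCW_cond theta S h s)%:E)%E.
Proof. by rewrite /pRFCW unlock. Qed.

Lemma pRFCW_ge0 s : (0 <= pRFCW mu theta S s)%E.
Proof. by rewrite pRFCW_integral; apply: integral_ge0 => h _; rewrite lee_fin pRFCW_cond_ge0. Qed.

Lemma sum_pRFCW (A : pred (n.-tuple bool)) : (\sum_(s | A s) pRFCW mu theta S s =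
  \int[iid_law mu n]_h (\sum_(s | A s) pRFCW_cond theta S h s)%:E)%E.
Proof.
under eq_bigr do rewrite pRFCW_integral.
rewrite -big_filter -ge0_integral_sum//.
- by apply: eq_integral => h _; rewrite sumEFin big_filter.
- by move=> s; apply/measurable_EFinP; exact: measurable_pRFCW_cond.
- by move=> s h _; rewrite lee_fin pRFCW_cond_ge0.
Qed.

Lemma sum_pRFCW1 : (\sum_s pRFCW mu theta S s = 1)%E.
Proof.
rewrite sum_pRFCW; under eq_integral do rewrite sum_pRFCW_cond.
exact: integral_probability_cst.
Qed.

Lemma pRFCW_fin_num s : pRFCW mu theta S s \is a fin_num.
Proof.
rewrite ge0_fin_numE ?pRFCW_ge0//; apply: (@le_lt_trans _ _ 1%E); last by rewrite ltry.
rewrite -sum_pRFCW1 (bigD1 s)//= leeDl//; apply: sume_ge0 => s' _; exact: pRFCW_ge0.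
Qed.

Lemma tuple_permK (U : Type) (pi : {perm 'I_n}) : cancel (@tuple_perm U n pi) (tuple_perm pi^-1).
Proof. by move=> t; apply: eq_from_tnth => i; rewrite !tnth_mktuple permKV. Qed.

Lemma spin_tuple_perm (pi : {perm 'I_n}) s i : spin (tuple_perm pi s) i = spin s (pi i) :> R.
Proof. by rewrite /spin tnth_mktuple. Qed.

Lemma pRFCW_weight_perm (pi : {perm 'I_n}) h s : (forall i, (pi i \in S) = (i \in S)) ->
  pRFCW_weight theta S (tuple_perm pi h) (tuple_perm pi s) = pRFCW_weight theta S h s.
Proof.
move=> piS; rewrite !pRFCW_weightE; congr (_ * _).
  rewrite /gibbs_coupling; congr (expR (_ * _ ^+ 2)).
  rewrite /magnetization [RHS](reindex_inj (@perm_inj _ pi))/=.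
  by apply: eq_big => i; [rewrite piS|rewrite spin_tuple_perm].
rewrite [RHS](reindex_inj (@perm_inj _ pi))/=.
by apply: eq_bigr => i _; rewrite spin_tuple_perm tnth_mktuple.
Qed.

(** A permutation acting on the fields and on the spins preserves the
    conditional law if it preserves [S], and the fields are exchangeable. *)
Lemma pRFCW_perm (pi : {perm 'I_n}) s : (forall i, (pi i \in S) = (i \in S)) ->
  pRFCW mu theta S (tuple_perm pi s) = pRFCW mu theta S s.
Proof.
move=> piS; rewrite !pRFCW_integral -(ge0_integral_iid_law_perm mu pi); last 2 first.
- by apply/measurable_EFinP; exact: measurable_pRFCW_cond.
- by move=> h; rewrite lee_fin pRFCW_cond_ge0.
apply: eq_integral => h _; congr EFin; rewrite /pRFCW_cond pRFCW_weight_perm//.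
congr (_ / _); rewrite [LHS](reindex_inj (can_inj (@tuple_permK bool pi)))/=.
by apply: eq_bigr => s' _; rewrite pRFCW_weight_perm.
Qed.

Definition flip_spin (i : 'I_n) s : n.-tuple bool :=
  [tuple if j == i then ~~ tnth s j else tnth s j | j < n].

Lemma flip_spinK i : involutive (flip_spin i).
Proof.
by move=> s; apply: eq_from_tnth => j; rewrite !tnth_mktuple; case: eqP => // _; rewrite negbK.
Qed.

(** The weight of [s] without the field term at [i]. *)
Definition weight_off (i : 'I_n) h s : R :=
  gibbs_coupling s * \prod_(j < n | j != i) expR (tnth h j * spin s j).

Lemma pRFCW_weight_split i h s :
  pRFCW_weight theta S h s = expR (tnth h i * spin s i) * weight_off i h s.
Proof. by rewrite pRFCW_weightE (bigD1 i)//= mulrCA. Qed.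

Lemma spin_flip_self i s : spin (flip_spin i s) i = - spin s i :> R.
Proof. by rewrite /spin tnth_mktuple eqxx; case: (tnth s i); rewrite ?opprK. Qed.

Lemma spin_flip_neq i j s : j != i -> spin (flip_spin i s) j = spin s j :> R.
Proof. by move=> /negbTE ji; rewrite /spin tnth_mktuple ji. Qed.

Lemma weight_off_flip i h s : i \notin S -> weight_off i h (flip_spin i s) = weight_off i h s.
Proof.
move=> iS; rewrite /weight_off; congr (_ * _).
  rewrite /gibbs_coupling; congr (expR (_ * _ ^+ 2)); apply: eq_bigr => j jS.
  by rewrite spin_flip_neq//; apply: contraNneq iS => <-.
by apply: eq_bigr => j ji; rewrite spin_flip_neq.
Qed.

Lemma partition_split i h : i \notin S ->
  \sum_s pRFCW_weight theta S h s = cosh (tnth h i) * \sum_s weight_off i h s.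
Proof.
move=> iS; set Z := LHS.
(* The configurations are paired with their flips at [i], counting each twice. *)
suff : Z + Z = 2 * (cosh (tnth h i) * \sum_s weight_off i h s) by lra.
rewrite {1}/Z [X in X + _](reindex_inj (can_inj (flip_spinK i)))/= /Z -big_split/=.
rewrite !mulr_sumr; apply: eq_bigr => s _.
rewrite !(pRFCW_weight_split i) weight_off_flip// spin_flip_self -mulrDl mulrA; congr (_ * _).
by rewrite /cosh /spin; case: (tnth s i); rewrite ?opprK ?mulr1 ?mulrN1; field.
Qed.

Lemma weight_off_gt0 i h s : 0 < weight_off i h s.
Proof. by rewrite mulr_gt0 ?expR_gt0//; apply: prodr_gt0 => j _; exact: expR_gt0. Qed.

Definition cond_off i h s : R := weight_off i h s / \sum_s' weight_off i h s'.

Lemma sum_weight_off_gt0 i h : 0 < \sum_s weight_off i h s.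
Proof.
rewrite (bigD1 [tuple true | i < n])//= ltr_pwDl ?weight_off_gt0//.
by apply: sumr_ge0 => s _; rewrite ltW ?weight_off_gt0.
Qed.

(** Outside the clique the spin [i] is independent of the other spins given
    the fields, with mean [tanh (tnth h i)]; [cond_off] is half the conditional
    law of the other spins, as its denominator sums over both values of that
    spin. *)
Lemma pRFCW_cond_split i h s : i \notin S ->
  pRFCW_cond theta S h s = (1 + spin s i * tanh (tnth h i)) * cond_off i h s.
Proof.
move=> iS; rewrite /pRFCW_cond (partition_split _ iS) (pRFCW_weight_split i) /cond_off.
rewrite invfM mulrACA; congr (_ * _).
rewrite (_ : 1 + spin s i * tanh (tnth h i) =
    (cosh (tnth h i) + spin s i * sinh (tnth h i)) / cosh (tnth h i)); last first.
  by rewrite /tanh; field; rewrite gt_eqF// cosh_gt0.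
congr (_ / _).
by rewrite /cosh /sinh /spin; case: (tnth s i); rewrite ?mulr1 ?mulrN1; field.
Qed.

Lemma measurable_cond_off i s :
  measurable_fun [set: n.-tuple (measurableTypeR R)] (fun h => cond_off i h s).
Proof.
have mw s' : measurable_fun [set: n.-tuple (measurableTypeR R)] (fun h => weight_off i h s').
  apply: measurable_funM => //.
  have -> : (fun h => \prod_(j < n | j != i) expR (tnth h j * spin s' j)) =
      (fun h => \prod_(j <- [seq j <- index_enum 'I_n | j != i]) expR (tnth h j * spin s' j)).
    by apply/funext => h; rewrite big_filter.
  apply: measurable_prod => j _; apply: measurableT_comp => //.
  by apply: measurable_funM => //; exact: measurable_tnth.
apply: measurable_funM => //; apply: measurable_funV_gt0; last exact: sum_weight_off_gt0.
by apply: measurable_sum.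
Qed.

(** Averaging over the field at [i] makes the spin fair, as [E[tanh h] = 0]. *)
Lemma pRFCW_off i s : i \notin S ->
  (pRFCW mu theta S s = \int[iid_law mu n]_h (cond_off i h s)%:E)%E.
Proof.
move=> iS; rewrite pRFCW_integral.
under eq_integral do rewrite (pRFCW_cond_split _ _ iS).
have sp : spin s i = 1 :> R \/ spin s i = -1 :> R by rewrite /spin; case: ifP; [left|right].
rewrite (ge0_integral_iid_law_coord mu (i := i) (a := fun x => 1 + spin s i * tanh x)
  (g := fun h => cond_off i h s)); last 5 first.
- by apply: measurable_funD => //; apply: measurable_funM => //; exact: measurable_tanh.
- move=> x; have /ler_normlP[h1 h2] := norm_tanh_le1 x.
  by case: sp => ->; lra.
- exact: measurable_cond_off.
- by move=> h; rewrite divr_ge0// ltW// ?weight_off_gt0 ?sum_weight_off_gt0.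
- have woff h h' s' : (forall j, j != i -> tnth h j = tnth h' j) -> weight_off i h s' = weight_off i h' s'.
    by move=> hh'; congr (_ * _); apply: eq_bigr => j ji; rewrite hh'.
  move=> h h' hh'; rewrite /cond_off (woff _ h')//; congr (_ / _).
  by apply: eq_bigr => s' _; exact: woff.
have -> : (\int[mu]_x (1 + spin s i * tanh x)%:E = 1)%E.
  transitivity (\int[mu]_x (1 + spin s i * tanh x + 0 * tanh x)%:E)%E.
    by apply: eq_integral => x _; rewrite mul0r addr0.
  rewrite integral_affine//; try exact: measurable_tanh; try exact: norm_tanh_le1.
  by move: mean_tanh; rewrite unlock => ->; rewrite !mule0 !adde0.
by rewrite mul1e.
Qed.

Lemma pRFCW_flip i s : i \notin S -> pRFCW mu theta S (flip_spin i s) = pRFCW mu theta S s.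
Proof.
move=> iS; rewrite !(pRFCW_off _ iS); apply: eq_integral => h _.
by rewrite /cond_off weight_off_flip.
Qed.

End symmetry.

Section exchangeability.
Context {R : realType} (mu : probability (measurableTypeR R) R) (theta : R).
Context (mean_tanh : ('E_mu[fun x : R => tanh x] = 0)%E).
Context (n : nat) (S : {set 'I_n}).
Implicit Types (h : n.-tuple (measurableTypeR R)) (s : n.-tuple bool).

Let disagreement s s' := [set i in 'I_n | tnth s i != tnth s' i].

Lemma tuple_perm_tperm (U : Type) (i j : 'I_n) (t : n.-tuple U) l :
  tnth (tuple_perm (tperm i j) t) l =
  if l == i then tnth t j else if l == j then tnth t i else tnth t l.
Proof.
rewrite tnth_mktuple; case: tpermP => [->|->|/eqP/negbTE -> /eqP/negbTE ->//].
  by rewrite eqxx.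
by rewrite eqxx; case: eqP => // ->.
Qed.

(** Induction on the number of sites where the configurations disagree. A
    disagreement outside [S] is removed by a flip; if there is none, equality of
    the numbers of plus spins provides two opposite disagreements in [S], removed
    by a swap. *)
Lemma pRFCW_exchangeable s s' : nplus S s = nplus S s' ->
  pRFCW mu theta S s = pRFCW mu theta S s'.
Proof.
move: {2}(#|disagreement s s'|) (leqnn #|disagreement s s'|) => N.
elim: N s => [|N IH] s.
  rewrite leqn0 cards_eq0 => /eqP d0 _; congr (pRFCW _ _ _ _).
  apply: eq_from_tnth => i; apply/eqP; move: (finset.in_set0 i).
  by rewrite -d0 inE /= => /negbT; rewrite negbK.
move=> dN ss'.
have [dS|] := boolP (disagreement s s' \subset S); last first.
  move=> /subsetPn[i]; rewrite inE /= => si iS.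
  rewrite -(pRFCW_flip theta mean_tanh s iS); apply: IH.
    rewrite -ltnS; apply: leq_trans dN; apply: proper_card.
    apply/properP; split.
      apply/fintype.subsetP => j; rewrite !inE/= tnth_mktuple.
      by case: (j =P i) => [->|//]; rewrite si.
    exists i; rewrite !inE//= tnth_mktuple eqxx negbK.
    by move: si; case: (tnth s i); case: (tnth s' i).
  rewrite -ss'; apply: eq_card => j; rewrite !inE tnth_mktuple.
  by case: (j =P i) => // ->; rewrite (negbTE iS).
pose A := [set i in S | tnth s i]; pose A' := [set i in S | tnth s' i].
have AE : A = A' -> s = s'.
  move=> AA; apply: eq_from_tnth => i; have [iS|iS] := boolP (i \in S).
    by move/setP/(_ i): AA; rewrite !inE iS.
  apply/eqP; move: iS; apply: contraNT => sn; apply: (fintype.subsetP dS).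
  by rewrite inE.
have [/eqP AA|nAA] := boolP (A == A'); first by rewrite AE.
have cAA : #|A| = #|A'| by exact: ss'.
have [i iA iA'] : exists2 i, i \in A & i \notin A'.
  apply/subsetPn; apply: contra nAA => sub.
  by rewrite eqEcard sub cAA leqnn.
have [j jA' jA] : exists2 j, j \in A' & j \notin A.
  apply/subsetPn; apply: contra nAA => sub.
  by rewrite eq_sym eqEcard sub cAA leqnn.
move: iA iA' jA' jA; rewrite !inE => /andP[iS si]; rewrite iS/= => s'i.
move=> /andP[jS s'j]; rewrite jS/= => sj.
have ij : i != j by apply: contraNneq sj => <-.
have tS l : (tperm i j l \in S) = (l \in S) by case: tpermP => // ->; rewrite iS jS.
rewrite -(pRFCW_perm mu theta s tS).
apply: IH.
  rewrite -ltnS; apply: leq_trans dN; apply: proper_card; apply/properP; split.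
    apply/fintype.subsetP => l; rewrite !inE/= tuple_perm_tperm.
    case: (l =P i) => [->|_]; first by rewrite si (negbTE s'i).
    by case: (l =P j) => [->|//]; rewrite s'j (negbTE sj).
  exists i; rewrite !inE/=; first by rewrite si (negbTE s'i).
  by rewrite tuple_perm_tperm eqxx (negbTE sj) (negbTE s'i).
rewrite -ss' /nplus -[RHS](card_imset _ (@perm_inj _ (tperm i j))).
apply: eq_card => l; rewrite inE tnth_mktuple.
apply/andP/imsetP => [[lS sl]|[l' l'A ->]].
  exists (tperm i j l); last by rewrite tpermK.
  by rewrite inE sl andbT; case: tpermP.
by move: l'A; rewrite inE tpermK => /andP[l'S ->]; split=> //; case: tpermP.
Qed.

(** * The magnetization of the clique does not vanish *)

Lemma sum_tilted_product (f : 'I_n -> R) :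
  \sum_(s : n.-tuple bool) \prod_(i < n) expR (f i * spin s i) = \prod_(i < n) (2 * cosh (f i)).
Proof.
rewrite (big_tuple_bool_distr (fun i b => expR (f i * (if b then 1 else -1)))).
by apply: eq_bigr => i _; rewrite mulr1 mulrN1 /cosh mulrC divfK// pnatr_eq0.
Qed.

(** The external field [u] on the clique, used as a trial tilt. *)
Definition on_clique (u : R) (i : 'I_n) : R := if i \in S then u else 0.

(** The square in the coupling is bounded below by its tangent:
    [(theta * M - k * u) ^+ 2 >= 0], which turns the interaction into an external
    field [u] on the clique, that is, into a product weight. *)
Lemma partition_ge (u : R) h : 0 < theta -> (0 < #|S|)%N ->
  expR (- (#|S|%:R * (u ^+ 2 / (2 * theta)))) *
    \prod_(i < n) (2 * cosh (tnth h i + on_clique u i)) <=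
  \sum_s pRFCW_weight theta S h s.
Proof.
move=> th0 S0; rewrite -sum_tilted_product mulr_sumr; apply: ler_sum => s _.
have k0 : (0 : R) < #|S|%:R by rewrite ltr0n.
rewrite pRFCW_weightE.
under eq_bigr do rewrite mulrDl expRD.
rewrite big_split/= mulrCA mulrC ler_pM2r; last first.
  by apply: prodr_gt0 => i _; exact: expR_gt0.
rewrite -expR_sum -expRD ler_expR.
have -> : \sum_(i < n) on_clique u i * spin s i = u * magnetization S s.
  rewrite /magnetization mulr_sumr [RHS]big_mkcond/=; apply: eq_bigr => i _.
  by rewrite /on_clique; case: ifP => // _; rewrite mul0r.
set M := magnetization S s; set k := #|S|%:R in k0 *.
rewrite -subr_ge0.
have -> : theta / (2 * k) * M ^+ 2 - (- (k * (u ^+ 2 / (2 * theta))) + u * M) =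
    (theta * M - k * u) ^+ 2 / (2 * k * theta).
  by field; rewrite !gt_eqF.
by rewrite divr_ge0 ?sqr_ge0// !mulr_ge0// ltW.
Qed.

Lemma sum_small_weight_le (eps : R) h : 0 < theta -> (0 < #|S|)%N -> 0 <= eps ->
  \sum_(s | `|magnetization S s| <= eps * #|S|%:R) pRFCW_weight theta S h s <=
  expR (#|S|%:R * (theta * eps ^+ 2 / 2)) * \prod_(i < n) (2 * cosh (tnth h i)).
Proof.
move=> th0 S0 e0; have k0 : (0 : R) < #|S|%:R by rewrite ltr0n.
rewrite -sum_tilted_product mulr_sumr.
rewrite [X in _ <= X](bigID (fun s => `|magnetization S s| <= eps * #|S|%:R))/=.
rewrite -[X in X <= _]addr0; apply: lerD; last first.
  by apply: sumr_ge0 => s _; rewrite mulr_ge0 ?expR_ge0// prodr_ge0// => i _; exact: expR_ge0.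
apply: ler_sum => s Ms; rewrite pRFCW_weightE; apply: ler_wpM2r.
  by apply: prodr_ge0 => i _; exact: expR_ge0.
rewrite ler_expR.
have M2 : magnetization S s ^+ 2 <= (eps * #|S|%:R) ^+ 2.
  by rewrite -[X in X <= _]real_normK ?num_real// ler_sqr ?nnegrE// mulr_ge0// ltW.
have -> : #|S|%:R * (theta * eps ^+ 2 / 2) = theta / (2 * #|S|%:R) * (eps * #|S|%:R) ^+ 2.
  by field; rewrite gt_eqF.
by apply: ler_wpM2l => //; rewrite divr_ge0 ?ltW// mulr_gt0.
Qed.

(** The ratio of [sum_small_weight_le] and [partition_ge]. As a probability is
    at most 1, it may be replaced by its power [sg <= 1]; this is what allows
    to average the bound over the fields, where the expectation of the
    ratio itself could be large because of atypical fields. *)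
Lemma sum_small_cond_le (eps u sg : R) h :
  0 < theta -> (0 < #|S|)%N -> 0 <= eps -> 0 <= sg <= 1 ->
  \sum_(s | `|magnetization S s| <= eps * #|S|%:R) pRFCW_cond theta S h s <=
  expR (sg * (#|S|%:R * (theta * eps ^+ 2 / 2 + u ^+ 2 / (2 * theta)))) *
  \prod_(i < n) (if i \in S then expR (- sg * lcosh_incr u (tnth h i)) else 1).
Proof.
move=> th0 S0 e0 /andP[sg0 sg1]; set a := theta * eps ^+ 2 / 2 + u ^+ 2 / (2 * theta).
set rho := (X in X <= _).
have rho1 : rho <= 1.
  rewrite -(sum_pRFCW_cond theta S h) [X in _ <= X](bigID (fun s => `|magnetization S s| <= eps * #|S|%:R))/=.
  by rewrite lerDl; apply: sumr_ge0 => s _; exact: pRFCW_cond_ge0.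
pose Y := #|S|%:R * a - \sum_(i in S) lcosh_incr u (tnth h i).
have -> : expR (sg * (#|S|%:R * a)) *
    \prod_(i < n) (if i \in S then expR (- sg * lcosh_incr u (tnth h i)) else 1) = expR (sg * Y).
  by rewrite -big_mkcond/= -expR_sum -expRD; congr expR; rewrite -mulr_sumr /Y; ring.
have rhoY : rho <= expR Y.
  rewrite /rho -mulr_suml ler_pdivrMr ?partition_gt0//.
  apply: le_trans (sum_small_weight_le h th0 S0 e0) _.
  apply: le_trans (ler_wpM2l (expR_ge0 _) (partition_ge u h th0 S0)).
  have -> : \prod_(i < n) (2 * cosh (tnth h i)) =
      expR (- \sum_(i in S) lcosh_incr u (tnth h i)) *
      \prod_(i < n) (2 * cosh (tnth h i + on_clique u i)).
    rewrite -sumrN expR_sum [X in _ = X * _]big_mkcond/= -big_split/=; apply: eq_bigr => i _.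
    rewrite /on_clique; case: ifP => _; last by rewrite addr0 mul1r.
    have c0 := cosh_gt0 (tnth h i); have c1 := cosh_gt0 (tnth h i + u).
    have cp : cosh (tnth h i + u) / cosh (tnth h i) \is Num.pos by rewrite posrE divr_gt0.
    by rewrite expRN /lcosh_incr (lnK cp); field; rewrite !gt_eqF.
  rewrite (mulrA (expR _)) [X in _ <= X](mulrA (expR _)) -!expRD le_eqVlt; apply/orP; left; apply/eqP.
  by congr (expR _ * _); rewrite /Y /a; ring.
(* [rho <= min 1 (expR Y)], which is at most [expR (sg * Y)] for either sign of [Y]. *)
case: (leP 0 Y) => Y0; first by apply: le_trans rho1 _; rewrite -expR0 ler_expR mulr_ge0.
by apply: le_trans rhoY _; rewrite ler_expR; nra.
Qed.

Lemma pRFCW_small_magnetization_le (eps u sg : R)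
    (v := fine 'E_mu[fun x => (sech x ^+ 2)%R]%E) :
  0 < theta -> (0 < #|S|)%N -> 0 <= eps -> 0 <= sg <= 1 -> 0 <= u -> sg * u <= 1 / 3 ->
  \sum_(s | `|magnetization S s| <= eps * #|S|%:R) fine (pRFCW mu theta S s) <=
  expR (#|S|%:R * (sg * (theta * eps ^+ 2 / 2 + u ^+ 2 / (2 * theta)
    - (v * (u ^+ 2 / 2 - 2 * u ^+ 3 / 3) - sg * u ^+ 2)))).
Proof.
move=> th0 S0 e0 /andP[sg0 sg1] u0 su.
rewrite -lee_fin -sumEFin.
under eq_bigr do rewrite fineK ?pRFCW_fin_num//.
rewrite sum_pRFCW.
pose r (i : 'I_n) (x : R) : R := if i \in S then expR (- sg * lcosh_incr u x) else 1.
have mr i : measurable_fun [set: R] (r i).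
  rewrite /r; case: (i \in S) => //; apply: measurableT_comp => //.
  by apply: measurable_funM => //; exact: measurable_lcosh_incr.
have r0 i x : 0 <= r i x by rewrite /r; case: ifP => // _; exact: expR_ge0.
pose K := expR (sg * (#|S|%:R * (theta * eps ^+ 2 / 2 + u ^+ 2 / (2 * theta)))).
have mpr : measurable_fun [set: n.-tuple (measurableTypeR R)] (fun h => \prod_(i < n) r i (tnth h i)).
  by apply: measurable_prod => i _; exact: (measurableT_comp (mr i) (measurable_tnth i)).
apply: (@le_trans _ _ (\int[iid_law mu n]_h (K%:E * (\prod_(i < n) r i (tnth h i))%:E))%E).
  apply: ge0_le_integral => //.
  - by move=> h _; rewrite lee_fin; apply: sumr_ge0 => s _; exact: pRFCW_cond_ge0.
  - apply/measurable_EFinP.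
    have -> : (fun h => \sum_(s | `|magnetization S s| <= eps * #|S|%:R) pRFCW_cond theta S h s) =
        (fun h => \sum_(s <- [seq s <- index_enum _ | `|magnetization S s| <= eps * #|S|%:R]) pRFCW_cond theta S h s).
      by apply/funext => h; rewrite big_filter.
    by apply: measurable_sum => s; exact: measurable_pRFCW_cond.
  - by apply/measurable_EFinP; exact: measurable_funM.
  - move=> h _; rewrite lee_fin; apply: sum_small_cond_le => //; exact/andP.
rewrite ge0_integralZl//; last 3 first.
- exact/measurable_EFinP.
- by move=> h _; rewrite lee_fin; apply: prodr_ge0.
- by rewrite lee_fin expR_ge0.
rewrite (ge0_integral_iid_law_prod mu (f := r))//.
pose J := sg * (v * (u ^+ 2 / 2 - 2 * u ^+ 3 / 3) - sg * u ^+ 2).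
have Jr i : (\int[mu]_x (r i x)%:E <= (if i \in S then expR (- J) else 1)%:E)%E.
  rewrite /r; case: ifP => _; last by rewrite integral_probability_cst.
  apply: le_trans (laplace_lcosh_incr_le mean_tanh u0 sg0 su) _.
  by rewrite lee_fin ler_expR /J mulNr.
apply: (@le_trans _ _ (K%:E * (\prod_(i < n) (if i \in S then expR (- J) else 1))%:E)%E).
  apply: lee_wpmul2l; first by rewrite lee_fin expR_ge0.
  rewrite -prodEFin.
  suff /andP[_ H] : (0 <= \prod_(i < n) \int[mu]_x (r i x)%:E <=
      \prod_(i < n) (if i \in S then expR (- J) else 1)%:E)%E by exact: H.
  apply: (big_ind2 (fun x y => 0 <= x <= y)%E) => [|x1 y1 x2 y2|i _].
  - by rewrite lee_fin ler01 lexx.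
  - by move=> /andP[x10 xy1] /andP[x20 xy2]; rewrite mule_ge0//= lee_pmul.
  - by rewrite Jr integral_ge0// => x _; rewrite lee_fin.
rewrite -EFinM lee_fin -big_mkcond/= prodr_const -expRM_natl -expRD ler_expR.
by rewrite /J; lra.
Qed.

End exchangeability.

Section magnetization_gap.
Context {R : realType}.

Lemma expectation_sech_sqr_le1 (mu : probability (measurableTypeR R) R) :
  fine 'E_mu[fun x => (sech x ^+ 2)%R]%E <= 1.
Proof.
have m2 : measurable_fun [set: R] (fun x : R => sech x ^+ 2).
  by apply: measurable_funX; exact: measurable_sech.
have le1 : ('E_mu[fun x => (sech x ^+ 2)%R] <= 1%:E)%E.
  rewrite unlock -(integral_probability_cst mu 1%:E); apply: ge0_le_integral => //.
  - by move=> x _; rewrite lee_fin sqr_ge0.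
  - exact/measurable_EFinP.
  - by move=> x _; rewrite lee_fin sech_sqr_le1.
rewrite -lee_fin fineK// ge0_fin_numE ?expectation_ge0//.
  by apply: le_lt_trans le1 _; rewrite ltry.
by move=> x; rewrite sqr_ge0.
Qed.

(** With [v = E[sech^2 h]] and [D = v - 1 / theta > 0], the leading part of the
    exponent of [pRFCW_small_magnetization_le] is [- sg * u ^+ 2 * D / 2]; with
    [u] and [sg] both equal to [D / 8] and [eps] small enough, the other terms
    do not compensate it. *)
Lemma pRFCW_magnetization_gap (mu : probability (measurableTypeR R) R) (theta : R) :
  0 < theta -> ('E_mu[fun x : R => tanh x] = 0)%E ->
  (fine 'E_mu[fun x : R => (sech x ^+ 2)%R]%E)^-1 < theta ->
  exists eps kappa : R, [/\ 0 < eps <= 1, 0 < kappa &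
    forall n (S : {set 'I_n}), (0 < #|S|)%N ->
      \sum_(s | `|magnetization S s| <= eps * #|S|%:R) fine (pRFCW mu theta S s) <=
      expR (- (kappa * #|S|%:R))].
Proof.
move=> th0 mt thv.
have v0 := expectation_sech_sqr_gt0 mu; have v1 := expectation_sech_sqr_le1 mu.
move: thv v0 v1; set v := fine _ => thv v0 v1.
pose D := v - theta^-1.
have D0 : 0 < D by rewrite subr_gt0 -(invrK v) ltf_pV2 ?posrE ?invr_gt0.
have D1 : D <= 1.
  by apply: le_trans v1; rewrite gerBl invr_ge0 ltW.
pose u := D / 8.
have u0 : 0 < u by rewrite /u divr_gt0.
pose eps := Num.min 1 (u ^+ 2 * D / (4 * theta)).
have eps0 : 0 < eps by rewrite lt_min ltr01/= divr_gt0// mulr_gt0// exprn_gt0.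
have eps1 : eps <= 1 by rewrite ge_min lexx.
have eps2 : theta * eps ^+ 2 / 2 <= u ^+ 2 * D / 8.
  have h : eps <= u ^+ 2 * D / (4 * theta) by rewrite ge_min lexx orbT.
  have h2 : theta * eps <= u ^+ 2 * D / 4.
    apply: le_trans (ler_wpM2l (ltW th0) h) _.
    by rewrite le_eqVlt; apply/orP; left; apply/eqP; field; rewrite gt_eqF.
  have h3 : theta * eps ^+ 2 <= theta * eps.
    by apply: ler_wpM2l; [exact: ltW|rewrite expr2 ler_piMr// ltW].
  lra.
pose kappa := u * (u ^+ 2 * D / 6).
exists eps, kappa; split; first by rewrite eps0.
  by rewrite mulr_gt0// divr_gt0// mulr_gt0// exprn_gt0.
move=> n S S0.
have u8 : u <= 1 / 8 by rewrite /u; lra.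
have su1 : 0 <= u <= 1 by rewrite ltW//=; lra.
have suu : u * u <= 1 / 3 by nra.
apply: le_trans (pRFCW_small_magnetization_le mt th0 S0 (ltW eps0) su1 (ltW u0) suu) _.
rewrite ler_expR [X in _ <= X](_ : _ = #|S|%:R * (u * - (u ^+ 2 * D / 6))); last by rewrite /kappa; ring.
apply: ler_wpM2l => //; rewrite -/v; apply: ler_wpM2l; first exact: ltW.
have -> : u ^+ 2 / (2 * theta) = u ^+ 2 * (v - D) / 2.
  by rewrite /D; field; rewrite gt_eqF.
have vu : v * (2 * u ^+ 3 / 3) <= u ^+ 2 * D / 12.
  have : v * (2 * u ^+ 3 / 3) <= 2 * u ^+ 3 / 3.
    by rewrite ler_piMl// divr_ge0// mulr_ge0// exprn_ge0// ltW.
  by rewrite exprS mulrC => h; apply: (le_trans h); rewrite {1}/u; lra.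
have uD : u * u ^+ 2 = u ^+ 2 * D / 8 by rewrite {1}/u; lra.
have : 0 <= u ^+ 2 * D by rewrite mulr_ge0 ?sqr_ge0 ?ltW.
lra.
Qed.

End magnetization_gap.

(** * From random variables to finite sums *)

Section transfer.
Context {R : realType}.

Lemma measurable_tuple_bool1 n (s : n.-tuple bool) : measurable [set s].
Proof.
rewrite (_ : [set s] = box (fun i => [set tnth s i])); first exact: measurable_box.
by apply/seteqP; split=> [_ -> //|t st]; apply: eq_from_tnth => i; exact: st.
Qed.

Lemma probability_bigcup_le (I : finType) d (T : measurableType d) (P : probability T R)
    (F : I -> set T) (A : pred I) (E : set T) : measurable E ->
  (forall i, measurable (F i)) -> (forall w, E w -> exists2 i, A i & F i w) ->
  (P E <= \sum_(i | A i) P (F i))%E.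
Proof.
move=> mE mF EF; apply: (@le_trans _ _ (P (\big[setU/set0]_(i | A i) F i))).
  apply: le_measure; rewrite ?inE//; first exact: bigsetU_measurable.
  by move=> w /EF[i Ai Fi]; rewrite (bigD1 i)//=; left.
rewrite big_mkcond [X in (_ <= X)%E]big_mkcond/=.
have : forall s : seq I, (P (\big[setU/set0]_(i <- s) (if A i then F i else set0)) <=
    \sum_(i <- s) (if A i then P (F i) else 0))%E.
  elim=> [|i s IH]; first by rewrite !big_nil measure0.
  rewrite !big_cons; apply: le_trans (measureU2 _ _ _) _ => //.
  - by case: ifP.
  - by apply: bigsetU_measurable => j _; case: ifP.
  - by apply: leeD => //; case: ifP => // _; rewrite measure0.
by apply.
Qed.

(** An event implied by a condition on the samples is bounded by the sum over
    the finitely many possible values of the samples. *)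
Lemma sample_event_le d (T : measurableType d) (P : probability T R) n m
    (p : n.-tuple bool -> R) (X : 'I_m -> {RV P >-> n.-tuple bool})
    (B : pred {ffun 'I_m -> n.-tuple bool}) (E : set T) :
  mutually_independent X -> (forall j s, P (X j @^-1` [set s]) = (p s)%:E) ->
  measurable E -> (forall w, E w -> B [ffun j => X j w]) ->
  (P E <= (\sum_(x | B x) \prod_(j < m) p (x j))%:E)%E.
Proof.
move=> indX PX mE EB.
pose F (x : {ffun 'I_m -> n.-tuple bool}) :=
  \bigcap_(j in [set` [set: 'I_m]%SET]) X j @^-1` [set x j].
have mXj j (s : n.-tuple bool) : measurable (X j @^-1` [set s]).
  by rewrite -[X in measurable X]setTI; apply: measurable_funP => //; exact: measurable_tuple_bool1.
have mF x : measurable (F x) by apply: fin_bigcap_measurable.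
have EF w : E w -> exists2 x, B x & F x w.
  by move=> /EB Bw; exists [ffun j => X j w] => // j _ /=; rewrite ffunE.
apply: (le_trans (probability_bigcup_le P mE mF EF)).
rewrite -sumEFin; apply: lee_sum => x _.
rewrite /F indX; last by move=> j; exact: measurable_tuple_bool1.
rewrite -prodEFin (eq_bigl xpredT); last by move=> j; rewrite inE.
by under eq_bigr do rewrite PX.
Qed.

End transfer.

(** * Asymptotics *)

Section asymptotics.
Context {R : realType}.

Lemma bin_le_expn n k : ('C(n, k) <= n ^ k)%N.
Proof.
apply: (@leq_trans (n ^_ k)); first by rewrite -bin_ffact leq_pmulr ?fact_gt0.
elim: k => [|k IH]; first by rewrite ffactn0.
by rewrite ffactnSr expnSr leq_mul// leq_subr.
Qed.

(** The ratio is at least [k >= 4 >= expR 1]. *)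
Lemma ln_ratio_ge1 n k : (4 <= k)%N -> k%:R <= Num.sqrt (n%:R : R) ->
  1 <= ln (n%:R / k%:R : R).
Proof.
move=> k4 kn.
have k0 : (0 : R) < k%:R by rewrite ltr0n; lia.
have kk : k%:R * k%:R <= n%:R :> R.
  by rewrite -expr2 -[X in _ <= X]sqr_sqrtr// ler_sqr ?nnegrE.
have nk : k%:R <= n%:R / k%:R :> R by rewrite ler_pdivlMr.
have nk0 : n%:R / k%:R \is @Num.pos R by rewrite posrE (lt_le_trans k0).
rewrite -ler_expR (lnK nk0); apply: le_trans nk.
have h : 1 / 2 <= expR (- (1 / 2)) :> R by apply: le_trans (expR_ge1Dx _); lra.
have e1 : expR 1 * expR (- (1 / 2)) ^+ 2 = 1 :> R.
  by rewrite -expRM_natl -expRD -[RHS]expR0; congr expR; field.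
have k4' : 4 <= k%:R :> R by rewrite (ler_nat R 4).
have h2 : 1 / 4 <= expR (- (1 / 2)) ^+ 2 :> R by nra.
have := ler_wpM2l (expR_ge0 (1 : R)) h2; rewrite e1; lra.
Qed.

(** This is where the clique has to be small: [k <= sqrt n] makes
    [n ^ k <= (n / k) ^ (2 * k)], so that the crude bound [n ^ k] on the number
    of candidates suffices. *)
Lemma ln_le_2ln_ratio n k : (4 <= k)%N -> k%:R <= Num.sqrt (n%:R : R) ->
  ln (n%:R : R) <= 2 * ln (n%:R / k%:R : R).
Proof.
move=> k4 kn.
have k0 : (0 : R) < k%:R by rewrite ltr0n; lia.
have kk : k%:R ^+ 2 <= n%:R :> R.
  by rewrite -[X in _ <= X]sqr_sqrtr// ler_sqr ?nnegrE.
have n0 : (0 : R) < n%:R by apply: lt_le_trans kk; rewrite exprn_gt0.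
have nk0 : (0 : R) < n%:R / k%:R by rewrite divr_gt0.
rewrite mulr_natl -lnXn// ler_ln ?posrE ?exprn_gt0//.
by rewrite expr_div_n ler_pdivlMr ?exprn_gt0// expr2 ler_wpM2l// ltW.
Qed.

(** From [x / 4 <= expR (x / 4)] raised to the fourth power. *)
Lemma polynomial_le_expR (a : R) k : 0 < a -> (1 <= k)%N -> 46 / a ^+ 2 <= k%:R ->
  2 * k.+1%:R ^+ 2 <= expR (a * k%:R).
Proof.
move=> a0 k1 ka.
have k1' : 1 <= k%:R :> R by rewrite (ler_nat R 1).
have a2 : 46 <= a ^+ 2 * k%:R by rewrite mulrC -ler_pdivrMr// exprn_gt0.
have -> : expR (a * k%:R) = expR (a * k%:R / 4) ^+ 4.
  by rewrite -expRM_natl; congr expR; field.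
have h : a * k%:R / 4 <= expR (a * k%:R / 4) by apply: le_trans (expR_ge1Dx _); lra.
apply: (@le_trans _ _ ((a * k%:R / 4) ^+ 4)); last first.
  by apply: lerXn2r; rewrite ?nnegrE ?expR_ge0// divr_ge0// mulr_ge0// ltW.
have -> : (a * k%:R / 4) ^+ 4 = (a ^+ 2 * k%:R) ^+ 2 * k%:R ^+ 2 / 256 by field.
have h1 : k.+1%:R ^+ 2 <= 4 * k%:R ^+ 2 :> R by rewrite -natr1; nra.
(* [46 ^+ 2 >= 2 * 4 * 256], the constants of the two bounds above. *)
have h2 : 46 ^+ 2 <= (a ^+ 2 * k%:R) ^+ 2.
  by rewrite ler_sqr ?nnegrE// (le_trans _ a2).
have h3 : 0 <= k%:R ^+ 2 :> R by exact: sqr_ge0.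
nra.
Qed.

(** The constant [192] is [3 * 64]: the exponent [eta ^+ 2 / 64 * k * m] is at
    least [3 * k * log (n / k)], while the number of candidates costs only
    [2 * k * log (n / k)]. *)
Lemma far_rival_bound_le n m k (eta kappa : R) : 0 < eta -> 0 < kappa ->
  (4 <= k)%N -> k%:R <= Num.sqrt (n%:R : R) ->
  192 / eta ^+ 2 * ln (n%:R / k%:R) <= m%:R ->
  46 / (eta ^+ 2 / 64) ^+ 2 <= k%:R -> 2 / kappa <= k%:R ->
  (2 * expR (- (kappa * k%:R / 2))) ^+ m +
  'C(n, k)%:R * (2 * k.+1%:R ^+ 2 * expR (- (eta ^+ 2 / 32 * k%:R))) ^+ m <=
  2 * expR (- (kappa * k%:R / 2)) + expR (- k%:R).
Proof.
move=> eta0 kappa0 k4 kn mC ke kk.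
have L1 := ln_ratio_ge1 k4 kn; have L2 := ln_le_2ln_ratio k4 kn.
move: L1 L2 mC; set L := ln (n%:R / k%:R) => L1 L2 mC.
have k0 : (0 : R) < k%:R by rewrite ltr0n; lia.
have eta2 : 0 < eta ^+ 2 by rewrite exprn_gt0.
have n0 : (0 : R) < n%:R.
  by rewrite -sqrtr_gt0; apply: lt_le_trans kn.
have m3 : 3 * L <= eta ^+ 2 / 64 * m%:R.
  have -> : 3 * L = eta ^+ 2 / 64 * (192 / eta ^+ 2 * L) by field; rewrite gt_eqF.
  by rewrite ler_wpM2l// divr_ge0// ltW.
have m0 : (0 < m)%N.
  rewrite -(ltr_nat R); apply: lt_le_trans mC; apply: mulr_gt0; last lra.
  by rewrite divr_gt0 ?ltr0n.
apply: lerD.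
  rewrite -[X in _ <= X]expr1; apply: ler_wiXn2l => //.
  have h : 2 <= expR (kappa * k%:R / 2).
    apply: le_trans (expR_ge1Dx _).
    have : 2 <= kappa * k%:R by rewrite mulrC -ler_pdivrMr.
    lra.
  by rewrite expRN ler_pdivrMr ?expR_gt0// mul1r.
have base : 2 * k.+1%:R ^+ 2 * expR (- (eta ^+ 2 / 32 * k%:R)) <= expR (- (eta ^+ 2 / 64 * k%:R)).
  have e64 : 0 < eta ^+ 2 / 64 by rewrite divr_gt0 ?ltr0n.
  have h := polynomial_le_expR e64 (leq_trans (isT : (1 <= 4)%N) k4) ke.
  apply: le_trans (ler_wpM2r (expR_ge0 _) h) _.
  by rewrite -expRD ler_expR; lra.
have binE : 'C(n, k)%:R <= expR (k%:R * (2 * L)) :> R.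
  apply: (@le_trans _ _ (n%:R ^+ k)); first by rewrite -natrX ler_nat bin_le_expn.
  rewrite -{1}(@lnK R n%:R) ?posrE// -expRM_natl ler_expR.
  by rewrite ler_wpM2l// ltW.
apply: (@le_trans _ _ (expR (k%:R * (2 * L)) * expR (- (eta ^+ 2 / 64 * k%:R)) ^+ m)).
  apply: ler_pM => //.
  by apply: lerXn2r; rewrite ?nnegrE ?expR_ge0// !mulr_ge0 ?expR_ge0// exprn_ge0.
rewrite -expRM_natl -expRD ler_expR.
have : k%:R * (3 * L) <= k%:R * (eta ^+ 2 / 64 * m%:R) by rewrite ler_wpM2l// ltW.
have : k%:R * 1 <= k%:R * L by rewrite ler_wpM2l// ltW.
lra.
Qed.

Lemma cvg_far_rival_bound (kappa : R) : 0 < kappa ->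
  (fun k => (2 * expR (- (kappa * k%:R / 2)) + expR (- k%:R) : R)%:E) @ \oo --> 0%:E.
Proof.
move=> kappa0; pose c := Num.min 1 (kappa / 2).
have c0 : 0 < c by rewrite lt_min ltr01/= divr_gt0.
have c1 : c <= 1 by rewrite ge_min lexx.
have ck : c <= kappa / 2 by rewrite ge_min lexx orbT.
apply: cvg_EFin; first by near=> k.
apply: (@squeeze_cvgr _ _ _ _ (fun=> 0) (fun k => 3 / c * harmonic k)).
- near=> k; apply/andP; split; first by rewrite addr_ge0 ?mulr_ge0 ?expR_ge0.
  have bnd (x : R) : c <= x -> expR (- (x * k%:R)) <= c^-1 * harmonic k.
    move=> cx; rewrite expRN /harmonic/= -invfM lef_pV2 ?posrE ?expR_gt0 ?mulr_gt0//.
    apply: le_trans (expR_ge1Dx _).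
    rewrite -natr1 mulrDr mulr1 addrC lerD// ler_wpM2r//.
  have h1 := bnd _ ck; have h2 := bnd _ c1.
  rewrite mul1r in h2; rewrite mulrAC in h1.
  have -> : 3 / c * harmonic k = 2 * (c^-1 * harmonic k) + c^-1 * harmonic k by ring.
  by apply: lerD => //; rewrite ler_wpM2l.
- exact: cvg_cst.
- rewrite -[X in _ --> X](mulr0 (3 / c)); apply: cvgMr; exact: cvg_harmonic.
Unshelve. all: by end_near.
Qed.

End asymptotics.

(** * Recovery of the clique *)

Theorem corollary3p4p1 (R : realType)
    (mu : probability (measurableTypeR R) R) (theta1 : R)
    (theta1_gt0 : 0 < theta1)
    (mean_tanh : ('E_mu[fun x : R => tanh x] = 0)%E)
    (theta1_gt : (fine 'E_mu[fun x : R => (sech x ^+ 2)%R]%E)^-1 < theta1) :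
  forall delta : R, 0 < delta ->
  exists2 C : R, 0 < C &
  forall (n m : nat -> nat)
    (d : nat -> measure_display)
    (Omega : forall k, measurableType (d k))
    (P : forall k, probability (Omega k) R)
    (S : forall k, {set 'I_(n k)})
    (sigma : forall k, 'I_(m k) -> {RV (P k) >-> (n k).-tuple bool})
    (Smax : forall k, Omega k -> {set 'I_(n k)}),
  (forall k, (k <= n k)%N) ->
  (fun k => k%:R : R^o) =o_\oo (fun k => Num.sqrt ((n k)%:R : R) : R^o) ->
  (\forall k \near \oo, C * ln ((n k)%:R / k%:R) <= (m k)%:R) ->
  (forall k, #|S k| = k) ->
  (forall k, iid_pRFCW_samples mu theta1 (S k) (sigma k)) ->
  (forall k S', measurable (Smax k @^-1` [set S'])) ->
  (forall k w, is_argmax_phi R k (fun j => sigma k j w) (Smax k w)) ->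
  (fun k => P k [set w | delta * k%:R <= #|symdiff (S k) (Smax k w)|%:R])
    @ \oo --> 0%:E.
Proof.
move=> delta delta0.
have [eps [kappa [eps01 kappa0 gap]]] := pRFCW_magnetization_gap theta1_gt0 mean_tanh theta1_gt.
(* Reducing [delta] to at most 1 only enlarges the event. *)
pose delta' := Num.min delta 1.
have delta'01 : 0 < delta' <= 1 by rewrite lt_min delta0 ltr01/= ge_min lexx orbT.
pose eta := delta' * eps / 4.
have eta0 : 0 < eta.
  by rewrite divr_gt0// mulr_gt0//; [case/andP: delta'01|case/andP: eps01].
exists (192 / eta ^+ 2); first by rewrite divr_gt0 ?ltr0n ?exprn_gt0.
move=> n m d Omega P S sigma Smax kn ko mC Sk iid mSmax argmax.
suff bnd : \forall k \near \oo,
    (0 <= P k [set w | (delta * k%:R <= #|symdiff (S k) (Smax k w)|%:R)%R] <=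
     (2 * expR (- (kappa * k%:R / 2)) + expR (- k%:R))%:E)%E.
  exact: (squeeze_cvge bnd (@cvg_cst _ _ _ _ _) (cvg_far_rival_bound kappa0)).
have small_k : \forall k \near \oo, k%:R <= Num.sqrt (n k)%:R :> R.
  move/eqoP: ko => /(_ 1 ltr01); apply: filterS => k /=.
  by rewrite mul1r normr_nat ger0_norm// sqrtr_ge0.
near=> k; rewrite measure_ge0/=.
have k4 : (4 <= k)%N by near: k; exact: nbhs_infty_ge.
have k0 : (0 < k)%N by exact: leq_trans k4.
have knk : k%:R <= Num.sqrt (n k)%:R :> R by near: k.
have mk : 192 / eta ^+ 2 * ln ((n k)%:R / k%:R) <= (m k)%:R by near: k.
have m0 : (0 < m k)%N.
  rewrite -(ltr_nat R); apply: lt_le_trans mk; apply: mulr_gt0.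
    by rewrite divr_gt0 ?ltr0n ?exprn_gt0.
  by apply: lt_le_trans (ln_ratio_ge1 k4 knk).
have ke : 46 / (eta ^+ 2 / 64) ^+ 2 <= k%:R.
  by near: k; exact: nbhs_infty_ger.
have kk : 2 / kappa <= k%:R by near: k; exact: nbhs_infty_ger.
pose p s := fine (pRFCW mu theta1 (S k) s).
have [indep marg] := iid k.
have sz : #|S k| = k := Sk k.
have S0 : (0 < #|S k|)%N by rewrite sz.
pose E := [set w | delta * k%:R <= #|symdiff (S k) (Smax k w)|%:R].
have mE : measurable E.
  have -> : E = \bigcup_(S' in [set S' | delta * k%:R <= #|symdiff (S k) S'|%:R]) (Smax k @^-1` [set S']).
    apply/seteqP; split=> [w Ew|w [S' ES' /= e]]; first by exists (Smax k w).
    by rewrite /E /= e.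
  by apply: fin_bigcup_measurable => // S' _; exact: mSmax.
have EB w : E w -> has_far_rival k delta' (S k) [ffun j => sigma k j w].
  move=> Ew; have [cmax Hmax] := argmax k w.
  apply/existsP; exists (Smax k w); rewrite cmax eqxx/=; apply/andP; split.
    by apply: le_trans Ew; rewrite ler_wpM2r// ge_min lexx.
  have -> : ([ffun j => sigma k j w] : 'I_(m k) -> (n k).-tuple bool) = (fun j => sigma k j w).
    by apply/funext => j; rewrite ffunE.
  exact: Hmax.
have Pp j s : P k (sigma k j @^-1` [set s]) = (p s)%:E by rewrite marg fineK// pRFCW_fin_num.
apply: (le_trans (sample_event_le indep Pp mE EB)); rewrite lee_fin.
apply: le_trans (far_rival_bound_le eta0 kappa0 k4 knk mk ke kk).
apply: sum_far_rival_le => //.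
- by move=> s; rewrite fine_ge0// pRFCW_ge0.
- apply/EFin_inj; rewrite -sumEFin -[RHS](sum_pRFCW1 mu theta1 (S k)).
  by apply: eq_bigr => s _; rewrite fineK// pRFCW_fin_num.
- by move=> s s' ss'; rewrite /p (pRFCW_exchangeable theta1 mean_tanh ss').
- by have := gap _ _ S0; rewrite sz.
Unshelve. all: by end_near.
Qed.
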